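(* Let $k_1\le k_2\le\dots\le k_n$ be natural numbers and let $D\subset\mathbb C^n$ be a $(k_1,\dots,k_n)$-balanced domain belonging to the class $\mathcal E$. If $2k_{m+1}>k_n$ for some $m$ with $0\le m\le n-1$, then the intersection $D_m=D\cap\{z_1=\dots=z_m=0\}$ is a convex set (where $D_m=D$ if $m=0$).
   Context: A domain $D\subset\mathbb C^n$ is $(k_1,\dots,k_n)$-balanced if $(\lambda^{k_1}z_1,\dots,\lambda^{k_n}z_n)\in D$ for all $z\in D$ and all $\lambda\in\mathbb C$ with $|\lambda|\le 1$. $\mathcal E$ is the class of domains that can be exhausted by domains biholomorphic to convex domains, i.e. $D\in\mathcal E$ if for every compact $K\subset D$ there is a domain $D'$ with $K\subset D'\subset D$ that is biholomorphic to a convex domain. *)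

(* Defs.v *)
From HB Require Import structures.
From mathcomp Require Import all_boot all_order all_algebra.
From mathcomp Require Import complex.
From mathcomp Require Import all_classical all_reals all_analysis.

Set Implicit Arguments.
Unset Strict Implicit.
Unset Printing Implicit Defensive.

Import Order.TTheory GRing.Theory Num.Theory.
Import numFieldNormedType.Exports.

Local Open Scope classical_set_scope.
Local Open Scope ring_scope.

(* The library puts the norm topology on the abstract numeric field types only;
   this makes it available on the concrete type R[i], hence on 'rV[R[i]]_n. *)
HB.instance Definition _ (R : rcfType) := NormedModule.copy R[i] R[i]^o.

Section ComplexDomains.
Variables (R : realType) (n : nat).
Local Notation Cn := 'rV[R[i]]_n.
Implicit Types (D G K : set Cn) (f : Cn -> Cn).

Definition domain D := [/\ D !=set0, open D & connected D].

(* [differentiable] is Frechet differentiability over the scalar field R[i],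
   that is, with a C-linear differential. *)
Definition holomorphic_on D f := forall z : Cn, D z -> differentiable f z.

(* Only the values of f on D and of g on G matter. *)
Definition biholomorphic D G :=
  exists f g : Cn -> Cn,
    [/\ holomorphic_on D f, holomorphic_on G g,
        f @` D `<=` G /\ g @` G `<=` D,
        {in D, cancel f g} & {in G, cancel g f}].

(* In R[i] the order 0 <= t <= 1 forces t to be real, so that [convex_set]
   over R[i] is convexity with respect to real segments. *)
Definition convex_domain G := domain G /\ convex_set G.

Definition classE D :=
  domain D /\
  forall K, compact K -> K `<=` D ->
    exists D', [/\ domain D', K `<=` D', D' `<=` D &
                   exists2 G, convex_domain G & biholomorphic D' G].

Definition weighted_balanced (k : 'I_n -> nat) D :=
  forall (lam : R[i]) (z : Cn), `|lam| <= 1 -> D z ->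
    D (\row_i (lam ^+ k i * z ord0 i)).

(* D intersected with the subspace where the first m coordinates vanish *)
Definition coord_slice (m : nat) D : set Cn :=
  D `&` [set z | forall i : 'I_n, (i < m)%N -> z ord0 i = 0].

End ComplexDomains.

(* Main.v *)
Require Import Defs.
From HB Require Import structures.
From mathcomp Require Import all_boot all_order all_algebra.
From mathcomp Require Import complex.
From mathcomp Require Import all_classical all_reals all_analysis.
From mathcomp Require Import ring lra.

Set Implicit Arguments.
Unset Strict Implicit.
Unset Printing Implicit Defensive.

Import Order.TTheory GRing.Theory Num.Theory.
Import numFieldNormedType.Exports.
Import ComplexField.Normc.

Local Open Scope classical_set_scope.
Local Open Scope ring_scope.

(** Fix a and b in the slice, a real t in [0, 1] and x = t a + (1 - t) b, and
    write [wscale l v] for the vector with coordinates l^(k i) v_i.  Choose a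
    subdomain D' of D containing the orbits of a and b under [wscale l] for
    |l| <= c, where c > 1, with a biholomorphic map f of D' onto a convex domain
    and its inverse g.  Convexity makes
    phi(l) = g (t f(wscale l a) + (1 - t) f(wscale l b))
    a holomorphic disc in D'.  The coordinates of wscale l a and wscale l b are
    O(l^(k m)), and conjugating a convex combination by f changes it only to
    second order ([convex_comb_expansion]), so that
    phi(l) = wscale l x + O(l^(2 k m)).  Because 2 k m exceeds every weight, the
    quotients h_i(l) = phi_i(l) / l^(k i) extend holomorphically across 0 with
    h(0) = x.  On the unit circle h(l) = wscale (1/l) (phi l) lies in D, since D
    is balanced.

    It remains to see that the centre of a holomorphic disc h with boundary in D
    lies in D ([balanced_disc]).  The discs wscale s (h l), for s from 0 to 1,
    join the point 0 to h and keep their boundaries in a compact subset of D.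
    Choose again D' and f for that compact set.  As long as such a disc lies in
    D', the maximum principle ([max_principle_convex]) keeps its image under f in
    a fixed compact convex set containing the images of the boundaries, which
    exists by [compact_in_convex]; so the disc cannot leave D' as s grows.

    The function theory that this needs starts from bare complex
    differentiability.  Goursat's theorem for rectangles, proved by bisection,
    gives Cauchy's formula on a square ([cauchy_formula]), where the circle is
    avoided so that no exponential enters; expanding the kernel gives Taylor
    expansions of order two with explicit remainders ([taylor_unit]).
    Everything else follows from these expansions: the removable singularity
    theorem, the maximum principle for real parts, and the quadratic estimate
    for maps of several variables ([taylor1_rV]). *)

(** * Moduli, limits and derivatives over R[i] *)

Section ComplexBasics.
Local Open Scope complex_scope.
Variable R : realType.
Local Notation C := R[i].
Implicit Types (z w : C) (e r : R).

Lemma norm_normc z : `|z| = (normc z)%:C.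
Proof. by []. Qed.

Lemma normc_ge0 z : 0 <= normc z.
Proof. by rewrite -ler0c -norm_normc. Qed.

Lemma normcD z w : normc (z + w) <= normc z + normc w.
Proof. by rewrite -lecR rmorphD /= -!norm_normc ler_normD. Qed.

Lemma normcN z : normc (- z) = normc z.
Proof. by apply: complexI; rewrite -!norm_normc normrN. Qed.

Lemma normcB z w : normc (z - w) <= normc z + normc w.
Proof. by rewrite -(normcN w) normcD. Qed.

Lemma normc_distC z w : normc (z - w) = normc (w - z).
Proof. by rewrite -normcN opprB. Qed.

Lemma normcX z n : normc (z ^+ n) = normc z ^+ n.
Proof. by elim: n => [|n IH]; rewrite ?normc1 // !exprS normcM IH. Qed.

Lemma normc_real r : normc r%:C = `|r|.
Proof. by rewrite /= expr0n /= addr0 sqrtr_sqr. Qed.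

Lemma normc_i : normc ('i : C) = 1.
Proof. by rewrite /= expr0n /= add0r expr1n sqrtr1. Qed.

Lemma normc_eq0 z : (normc z == 0) = (z == 0).
Proof. by apply/eqP/eqP => [/eq0_normc|->//]; rewrite ?normc0. Qed.

Lemma normc_gt0 z : (0 < normc z) = (z != 0).
Proof. by rewrite lt_def normc_ge0 andbT normc_eq0. Qed.

Lemma Re_le_normc z : `|complex.Re z| <= normc z.
Proof.
case: z => a b /=; rewrite -[leLHS]sqrtr_sqr ler_wsqrtr //.
by rewrite lerDl sqr_ge0.
Qed.

Lemma Im_le_normc z : `|complex.Im z| <= normc z.
Proof.
case: z => a b /=; rewrite -[leLHS]sqrtr_sqr ler_wsqrtr //.
by rewrite lerDr sqr_ge0.
Qed.

Lemma normc_le_ReIm z : normc z <= `|complex.Re z| + `|complex.Im z|.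
Proof.
have -> : z = (complex.Re z)%:C + 'i * (complex.Im z)%:C by rewrite -complexE.
apply: (le_trans (normcD _ _)); rewrite normcM normc_i mul1r !normc_real.
by rewrite -complexE.
Qed.

Lemma sqr_normc z : normc z ^+ 2 = complex.Re z ^+ 2 + complex.Im z ^+ 2.
Proof. by case: z => a b /=; rewrite sqr_sqrtr // addr_ge0 ?sqr_ge0. Qed.

Lemma gt0C z : 0 < z -> z = (complex.Re z)%:C /\ 0 < complex.Re z.
Proof. by case: z => a b; rewrite ltcE /= => /andP[/eqP -> ?]. Qed.

(** Radii in the norm topology of R[i] are complex numbers; positivity makes
    them real. *)
Lemma nbhsC z (A : set C) :
  nbhs z A <-> exists2 e : R, 0 < e & forall w, normc (w - z) < e -> A w.
Proof.
split.
- move/nbhs_ballP => [e /= /gt0C[-> e0] h]; exists (complex.Re e) => // w we.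
  by apply: h; rewrite -ball_normE /ball_ /= distrC norm_normc ltcR.
- move=> [e e0 h]; apply/nbhs_ballP; exists (e%:C)%C => /=; first by rewrite ltcR.
  by move=> w; rewrite -ball_normE /ball_ /= distrC norm_normc ltcR; exact: h.
Qed.

Lemma continuous_Re : continuous (@complex.Re R).
Proof.
move=> z; apply/(@cvgrPdist_lt _ _ _ (nbhs z)) => e e0; apply/nbhsC; exists e => // w.
apply: le_lt_trans; rewrite normc_distC.
by apply: le_trans (Re_le_normc _); case: z => a b; case: w.
Qed.

Lemma continuous_Im : continuous (@complex.Im R).
Proof.
move=> z; apply/(@cvgrPdist_lt _ _ _ (nbhs z)) => e e0; apply/nbhsC; exists e => // w.
apply: le_lt_trans; rewrite normc_distC.
by apply: le_trans (Im_le_normc _); case: z => a b; case: w.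
Qed.

Lemma continuous_normc : continuous (@normc R).
Proof.
move=> z; apply/(@cvgrPdist_lt _ _ _ (nbhs z)) => e e0; apply/nbhsC; exists e => // w.
apply: le_lt_trans; rewrite ler_norml; apply/andP; split.
- by rewrite lerNl opprB lerBlDr; apply: le_trans (normcD _ _); rewrite subrK.
- by rewrite lerBlDr normc_distC; apply: le_trans (normcD _ _); rewrite subrK.
Qed.

Lemma continuous_complex (f g : R -> R) x :
  {for x, continuous f} -> {for x, continuous g} ->
  {for x, continuous (fun t => (f t +i* g t : C))}.
Proof.
move=> hf hg A /nbhsC[e e0 h] /=.
have e2 : 0 < e / 2 by rewrite divr_gt0.
move/cvgrPdist_lt : hf => /(_ _ e2) hf.
move/cvgrPdist_lt : hg => /(_ _ e2) hg.
have : \forall t \near x, `|f x - f t| < e / 2 /\ `|g x - g t| < e / 2.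
  by near=> t; split; near: t.
apply: filterS => t [ft gt]; apply: h.
apply: le_lt_trans (normc_le_ReIm _) _ => /=.
by rewrite (splitr e) ltrD // distrC.
Unshelve. all: by end_near. Qed.

Lemma diff_quotientM (u : C -> C) z w (c : C) : w != 0 ->
  normc (u (z + w) - u z - c * w) =
  normc (c - w^-1 * (u (w * 1 + z) - u z)) * normc w.
Proof.
move=> w0; rewrite -normcM -normcN; congr normc; rewrite mulr1 [w + z]addrC.
by field.
Qed.

(** The difference quotient with real radii, in the form that the integral
    estimates use. *)
Lemma differentiableCP (u : C -> C) z : differentiable u z <->
  exists c, forall e, 0 < e -> exists2 d : R, 0 < d &
    forall w, normc w < d -> normc (u (z + w) - u z - c * w) <= e * normc w.
Proof.
split.
- move=> /derivable1_diffP; rewrite /derivable => /cvg_ex[/= c hc].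
  exists c => e e0.
  have ec : (0 : C) < e%:C by rewrite ltcR.
  move/cvgrPdist_lt : hc => /(_ _ ec) /nbhs_ballP[d /= /gt0C[-> d0] h].
  exists (complex.Re d) => // w wd.
  have [->|w0] := eqVneq w 0.
    by rewrite addr0 subrr mulr0 subr0 normc0 mulr0.
  have /h /(_ w0) : ball (0 : C) (complex.Re d)%:C w.
    by rewrite -ball_normE /ball_ /= sub0r normrN norm_normc ltcR.
  rewrite norm_normc ltcR => /ltW hw; rewrite diff_quotientM //.
  by apply: ler_wpM2r; [exact: normc_ge0|exact: hw].
- move=> [c hc]; apply/derivable1_diffP/cvg_ex; exists c => /=.
  apply/cvgrPdist_le => e /gt0C[-> e0]; have [d d0 h] := hc _ e0.
  apply/nbhsC; exists d => // w; rewrite subr0 => wd w0.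
  rewrite norm_normc lecR -(ler_pM2r (_ : 0 < normc w)) ?normc_gt0 //.
  by move: (h _ wd); rewrite diff_quotientM.
Qed.

End ComplexBasics.
#[global] Arguments normc {R} x : simpl never.

(** * Integrals of continuous functions over segments *)

Section RealIntegral.
Variable R : realType.
Implicit Types (f g : R -> R) (a b m : R).

Definition cont_itv a b f := forall x, a <= x <= b -> {for x, continuous f}.

Definition intg a b f : R := \int[lebesgue_measure]_(x in `[a, b]) f x.

Lemma cont_itv_integrable a b f : cont_itv a b f ->
  lebesgue_measure.-integrable `[a, b] (EFin \o f).
Proof.
move=> cf; apply: continuous_compact_integrable; first exact: segment_compact.
apply: continuous_in_subspaceT => x /set_mem /=; rewrite in_itv /= => xab.
exact: cf.
Qed.

Lemma intgD a b f g : cont_itv a b f -> cont_itv a b g ->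
  intg a b (fun x => f x + g x) = intg a b f + intg a b g.
Proof. by move=> cf cg; apply: RintegralD => //; exact: cont_itv_integrable. Qed.

Lemma intgZ a b r f : cont_itv a b f ->
  intg a b (fun x => r * f x) = r * intg a b f.
Proof. by move=> cf; apply: RintegralZl => //; exact: cont_itv_integrable. Qed.

Lemma le_intg a b f g : cont_itv a b f -> cont_itv a b g ->
  (forall x, a <= x <= b -> f x <= g x) -> intg a b f <= intg a b g.
Proof.
move=> cf cg h; apply: le_Rintegral => //; try exact: cont_itv_integrable.
Qed.

Lemma intg_cst a b r : a <= b -> intg a b (fun=> r) = r * (b - a).
Proof.
move=> ab; rewrite /intg Rintegral_cst //; congr (_ * _).
have E : fine (lebesgue_measure [set` `[a, b]]) = b - a.
  rewrite (@lebesgue_measure_itv R) /= lte_fin.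
  by move: ab; rewrite le_eqVlt => /predU1P[->|->//]; rewrite ltxx subrr.
exact: E.
Qed.

Lemma intg_split a m b f : a <= m <= b -> cont_itv a b f ->
  intg a b f = intg a m f + intg m b f.
Proof.
move=> /andP[am mb] cf.
have cf' := cont_itv_integrable cf.
have E : intg a b f - intg a m f =
    \int[lebesgue_measure]_(x in `]m, b]) f x.
  exact: (@Rintegral_itvB R f (BLeft a) (BRight b) m).
have E' : \int[lebesgue_measure]_(x in `]m, b]) f x = intg m b f.
  apply: Rintegral_itv_obnd_cbnd.
  apply: (integrableS _ _ _ cf') => //=.
  by apply: subset_itv; rewrite bnd_simp.
by rewrite -E' -E addrC subrK.
Qed.

Lemma intg_le a b f M : a <= b -> cont_itv a b f ->
  (forall x, a <= x <= b -> `|f x| <= M) -> `|intg a b f| <= M * (b - a).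
Proof.
move=> ab cf hM; rewrite ler_norml -mulNr -!intg_cst //.
have cc r : cont_itv a b (fun=> r) by move=> x _; exact: cvg_cst.
by apply/andP; split; apply: le_intg => // x /hM; rewrite ler_norml => /andP[].
Qed.

End RealIntegral.

(** * Contour integrals along rectangles *)

Section ComplexIntegral.
Local Open Scope complex_scope.
Variable R : realType.
Local Notation C := R[i].
Implicit Types (f g : R -> C) (u v w : C -> C) (a b c d : R).

Definition ccont_itv a b f := forall x, a <= x <= b -> {for x, continuous f}.

Definition cintg a b f : C :=
  intg a b (fun x => complex.Re (f x)) +i* intg a b (fun x => complex.Im (f x)).

Lemma ccont_itv_Re a b f : ccont_itv a b f -> cont_itv a b (fun x => complex.Re (f x)).
Proof.
move=> cf x /cf h.
exact: (@continuous_comp _ _ _ f (@complex.Re R) x h (@continuous_Re R _)).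
Qed.

Lemma ccont_itv_Im a b f : ccont_itv a b f -> cont_itv a b (fun x => complex.Im (f x)).
Proof.
move=> cf x /cf h.
exact: (@continuous_comp _ _ _ f (@complex.Im R) x h (@continuous_Im R _)).
Qed.

Lemma ccont_itvD a b f g : ccont_itv a b f -> ccont_itv a b g ->
  ccont_itv a b (fun x => f x + g x).
Proof. by move=> cf cg x xab; apply: cvgD; [exact: cf|exact: cg]. Qed.

Lemma ccont_itvB a b f g : ccont_itv a b f -> ccont_itv a b g ->
  ccont_itv a b (fun x => f x - g x).
Proof. by move=> cf cg x xab; apply: cvgB; [exact: cf|exact: cg]. Qed.

Lemma ccont_itvZ a b (k : C) f : ccont_itv a b f -> ccont_itv a b (fun x => k * f x).
Proof. by move=> cf x xab; apply: cvgMr; exact: cf. Qed.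

Lemma cintgD a b f g : ccont_itv a b f -> ccont_itv a b g ->
  cintg a b (fun x => f x + g x) = cintg a b f + cintg a b g.
Proof.
move=> cf cg; rewrite /cintg; simpc; rewrite -!intgD.
- by congr (intg _ _ _ +i* intg _ _ _); apply/funext => x;
    case: (f x) => ? ?; case: (g x).
- exact: ccont_itv_Im.
- exact: ccont_itv_Im.
- exact: ccont_itv_Re.
- exact: ccont_itv_Re.
Qed.

Lemma cintgZ a b (k : C) f : ccont_itv a b f ->
  cintg a b (fun x => k * f x) = k * cintg a b f.
Proof.
move=> cf; rewrite /cintg; case: k => p q; simpc.
have hr := ccont_itv_Re cf; have hi := ccont_itv_Im cf.
have cZ r h : cont_itv a b h -> cont_itv a b (fun x => r * h x).
  by move=> ch x xab; apply: cvgMr; exact: ch.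
rewrite -!intgZ // -mulN1r -intgZ; last exact: cZ.
have c1 := cZ p _ hr; have c2 := cZ (-1) _ (cZ q _ hi).
have c3 := cZ p _ hi; have c4 := cZ q _ hr.
rewrite -(intgD c1 c2) -(intgD c3 c4).
congr (intg _ _ _ +i* intg _ _ _); apply/funext => x.
  by case: (f x) => s t /=; ring.
by case: (f x) => s t /=; ring.
Qed.

Lemma cintgB a b f g : ccont_itv a b f -> ccont_itv a b g ->
  cintg a b (fun x => f x - g x) = cintg a b f - cintg a b g.
Proof.
move=> cf cg; have cg' := @ccont_itvZ a b (-1) g cg.
have := cintgD cf cg'; rewrite (cintgZ _ cg) mulN1r => <-.
by congr cintg; apply/funext => x; rewrite mulN1r.
Qed.

Lemma cintg_cst a b (k : C) : a <= b -> cintg a b (fun=> k) = k * (b - a)%:C.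
Proof. by move=> ab; rewrite /cintg !intg_cst //; case: k => ? ?; simpc. Qed.

Lemma cintg_split a m b f : a <= m <= b -> ccont_itv a b f ->
  cintg a b f = cintg a m f + cintg m b f.
Proof.
move=> amb cf; rewrite /cintg; simpc.
by rewrite -!intg_split //; [exact: ccont_itv_Im|exact: ccont_itv_Re].
Qed.

(** The factor 2 comes from bounding real and imaginary parts separately. *)
Lemma cintg_le a b f M : a <= b -> ccont_itv a b f ->
  (forall x, a <= x <= b -> normc (f x) <= M) ->
  normc (cintg a b f) <= 2 * M * (b - a).
Proof.
move=> ab cf hM; apply: le_trans (normc_le_ReIm _) _ => /=.
have -> : 2 * M * (b - a) = M * (b - a) + M * (b - a) by ring.
apply: lerD; apply: intg_le => //.
- exact: ccont_itv_Re.
- by move=> x /hM; apply: le_trans; exact: Re_le_normc.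
- exact: ccont_itv_Im.
- by move=> x /hM; apply: le_trans; exact: Im_le_normc.
Qed.

Definition rect_bd a b c d : set C := [set z : C |
  (a <= complex.Re z <= b /\ (complex.Im z = c \/ complex.Im z = d)) \/
  (c <= complex.Im z <= d /\ (complex.Re z = a \/ complex.Re z = b))].

(** Opposite sides are integrated together, bottom minus top and right minus
    left, which is the counterclockwise contour integral. *)
Definition rect_int a b c d w : C :=
  cintg a b (fun x => w (x +i* c) - w (x +i* d)) +
  'i * cintg c d (fun y => w (b +i* y) - w (a +i* y)).

Definition cont_on (A : set C) w := forall z, A z -> {for z, continuous w}.

Lemma continuousZ_at (k : C) w z : {for z, continuous w} ->
  {for z, continuous (fun t => k * w t)}.
Proof.
move=> h; apply: (@continuousM C C (fun=> k) w z); last exact: h.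
exact: cst_continuous.
Qed.

Lemma continuousD_at v w z : {for z, continuous v} -> {for z, continuous w} ->
  {for z, continuous (fun t => v t + w t)}.
Proof. move=> h h'. exact: (@continuousD C C C v w z h h'). Qed.

Lemma horiz_cont a b y w : (forall x, a <= x <= b -> {for x +i* y, continuous w}) ->
  ccont_itv a b (fun x => w (x +i* y)).
Proof.
move=> h x /h; apply: (@continuous_comp _ _ _ (fun t : R => t +i* y : C) w).
by apply: (@continuous_complex R id (fun=> y)); [exact: cvg_id|exact: cvg_cst].
Qed.

Lemma vert_cont c d x w : (forall y, c <= y <= d -> {for x +i* y, continuous w}) ->
  ccont_itv c d (fun y => w (x +i* y)).
Proof.
move=> h y /h; apply: (@continuous_comp _ _ _ (fun t : R => x +i* t : C) w).
by apply: (@continuous_complex R (fun=> x) id); [exact: cvg_cst|exact: cvg_id].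
Qed.

Section Boundary.
Variables (a b c d : R).
Hypotheses (ab : a <= b) (cd : c <= d).

Let boundary_cont w : cont_on (rect_bd a b c d) w ->
  [/\ ccont_itv a b (fun x => w (x +i* c)), ccont_itv a b (fun x => w (x +i* d)),
      ccont_itv c d (fun y => w (b +i* y)) & ccont_itv c d (fun y => w (a +i* y))].
Proof.
move=> cw; split; [apply: horiz_cont|apply: horiz_cont|apply: vert_cont|
  apply: vert_cont] => t ht; apply: cw; rewrite /rect_bd /=; tauto.
Qed.

Lemma rect_intD v w : cont_on (rect_bd a b c d) v -> cont_on (rect_bd a b c d) w ->
  rect_int a b c d (fun z => v z + w z) = rect_int a b c d v + rect_int a b c d w.
Proof.
move=> /boundary_cont[v1 v2 v3 v4] /boundary_cont[w1 w2 w3 w4]; rewrite /rect_int.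
rewrite (cintgB (ccont_itvD v1 w1) (ccont_itvD v2 w2)) (cintgD v1 w1) (cintgD v2 w2).
rewrite (cintgB (ccont_itvD v3 w3) (ccont_itvD v4 w4)) (cintgD v3 w3) (cintgD v4 w4).
rewrite (cintgB v1 v2) (cintgB w1 w2) (cintgB v3 v4) (cintgB w3 w4).
by ring.
Qed.

Lemma rect_intZ k w : cont_on (rect_bd a b c d) w ->
  rect_int a b c d (fun z => k * w z) = k * rect_int a b c d w.
Proof.
move=> /boundary_cont[w1 w2 w3 w4]; rewrite /rect_int.
rewrite (cintgB (@ccont_itvZ _ _ k _ w1) (@ccont_itvZ _ _ k _ w2)).
rewrite (cintgB (@ccont_itvZ _ _ k _ w3) (@ccont_itvZ _ _ k _ w4)).
rewrite !(cintgZ k w1, cintgZ k w2, cintgZ k w3, cintgZ k w4).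
rewrite (cintgB w1 w2) (cintgB w3 w4).
by ring.
Qed.

Lemma cont_onZ A (k : C) w : cont_on A w -> cont_on A (fun z => k * w z).
Proof. by move=> cw z /cw; exact: continuousZ_at. Qed.

Lemma cont_onD A v w : cont_on A v -> cont_on A w -> cont_on A (fun z => v z + w z).
Proof. by move=> cv cw z zA; apply: continuousD_at; [exact: cv|exact: cw]. Qed.

Lemma rect_intB v w : cont_on (rect_bd a b c d) v -> cont_on (rect_bd a b c d) w ->
  rect_int a b c d (fun z => v z - w z) = rect_int a b c d v - rect_int a b c d w.
Proof.
move=> cv cw; have := rect_intD cv (@cont_onZ _ (-1) _ cw).
rewrite (rect_intZ (-1) cw) mulN1r => <-.
by congr rect_int; apply/funext => z; rewrite mulN1r.
Qed.

Lemma rect_int_le w M : cont_on (rect_bd a b c d) w ->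
  (forall z, rect_bd a b c d z -> normc (w z) <= M) ->
  normc (rect_int a b c d w) <= 4 * M * ((b - a) + (d - c)).
Proof.
move=> /boundary_cont[w1 w2 w3 w4] hM; rewrite /rect_int.
apply: le_trans (normcD _ _) _; rewrite normcM normc_i mul1r.
have -> : 4 * M * ((b - a) + (d - c)) =
  2 * (2 * M) * (b - a) + 2 * (2 * M) * (d - c) by ring.
apply: lerD; apply: cintg_le; [exact: ab|exact: ccont_itvB| |exact: cd|
  exact: ccont_itvB|].
- move=> x xab; apply: le_trans (normcB _ _) _; rewrite mulr_natl mulr2n.
  by apply: lerD; apply: hM; rewrite /rect_bd /=; tauto.
- move=> x xab; apply: le_trans (normcB _ _) _; rewrite mulr_natl mulr2n.
  by apply: lerD; apply: hM; rewrite /rect_bd /=; tauto.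
Qed.

Lemma rect_int_affine (p q : C) : rect_int a b c d (fun z => p + q * z) = 0.
Proof.
rewrite /rect_int.
have -> : (fun x : R => p + q * (x +i* c) - (p + q * (x +i* d))) =
    (fun=> q * (0 +i* (c - d))).
  apply/funext => x; rewrite [LHS](_ : _ = q * ((x +i* c) - (x +i* d))); last ring.
  by simpc.
have -> : (fun y : R => p + q * (b +i* y) - (p + q * (a +i* y))) =
    (fun=> q * ((b - a) +i* 0)).
  apply/funext => x; rewrite [LHS](_ : _ = q * ((b +i* x) - (a +i* x))); last ring.
  by simpc.
rewrite !cintg_cst //; case: q => q1 q2; simpc.
by congr (_ +i* _); ring.
Qed.

End Boundary.

Definition rect_in a b c d : set C :=
  [set z : C | a <= complex.Re z <= b /\ c <= complex.Im z <= d].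

Lemma rect_int_splitx a m b c d w : a <= m <= b -> c <= d ->
  cont_on (rect_bd a m c d) w -> cont_on (rect_bd m b c d) w ->
  rect_int a b c d w = rect_int a m c d w + rect_int m b c d w.
Proof.
move=> /andP[am mb] cd c1 c2.
have hc y : y = c \/ y = d -> ccont_itv a b (fun x => w (x +i* y)).
  move=> hy; apply: horiz_cont => x /andP[ax xb].
  have [xm|mx] := leP x m; [apply: c1|apply: c2]; rewrite /rect_bd /=; left.
    by split; [rewrite ax xm|exact: hy].
  by split; [rewrite (ltW mx) xb|exact: hy].
have hv x : x = a \/ x = m \/ x = b -> ccont_itv c d (fun y => w (x +i* y)).
  move=> hx; apply: vert_cont => y hy.
  case: hx => [->|[->|->]]; [apply: c1|apply: c1|apply: c2];
  rewrite /rect_bd /=; tauto.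
rewrite /rect_int (@cintg_split a m b); first last.
- by apply: ccont_itvB; apply: hc; tauto.
- by rewrite am.
have va := hv a (or_introl erefl).
have vm := hv m (or_intror (or_introl erefl)).
have vb := hv b (or_intror (or_intror erefl)).
by rewrite (cintgB vb va) (cintgB vm va) (cintgB vb vm); ring.
Qed.

Lemma rect_int_splity a b c m d w : a <= b -> c <= m <= d ->
  cont_on (rect_bd a b c m) w -> cont_on (rect_bd a b m d) w ->
  rect_int a b c d w = rect_int a b c m w + rect_int a b m d w.
Proof.
move=> ab /andP[cm md] c1 c2.
have hc x : x = a \/ x = b -> ccont_itv c d (fun y => w (x +i* y)).
  move=> hx; apply: vert_cont => y /andP[cy yd].
  have [ym|my] := leP y m; [apply: c1|apply: c2]; rewrite /rect_bd /=; right.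
    by split; [rewrite cy ym|exact: hx].
  by split; [rewrite (ltW my) yd|exact: hx].
have hv y : y = c \/ y = m \/ y = d -> ccont_itv a b (fun x => w (x +i* y)).
  move=> hy; apply: horiz_cont => x hx.
  case: hy => [->|[->|->]]; [apply: c1|apply: c1|apply: c2];
  rewrite /rect_bd /=; tauto.
rewrite /rect_int (@cintg_split c m d); first last.
- by apply: ccont_itvB; apply: hc; tauto.
- by rewrite cm.
have vc := hv c (or_introl erefl).
have vm := hv m (or_intror (or_introl erefl)).
have vd := hv d (or_intror (or_intror erefl)).
by rewrite (cintgB vc vd) (cintgB vc vm) (cintgB vm vd); ring.
Qed.

End ComplexIntegral.
#[global] Arguments rect_int {R} a b c d w : simpl never.

(** * Goursat's theorem *)

Section Goursat.
Local Open Scope complex_scope.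
Variable R : realType.
Local Notation C := R[i].
Implicit Types (w : C -> C) (a b c d : R).

Definition holomorphic_in (A : set C) w := forall z, A z -> differentiable w z.

Lemma rect_bd_in a b c d : a <= b -> c <= d ->
  rect_bd a b c d `<=` rect_in a b c d.
Proof.
by move=> ab cd z [] [h [] e]; split=> //; rewrite e ?lexx ?ab ?cd.
Qed.

Lemma holo_cont_on (A : set C) w : holomorphic_in A w -> cont_on A w.
Proof. by move=> hw z /hw; exact: differentiable_continuous. Qed.

Lemma rect_inS a b c d a' b' c' d' : a <= a' -> b' <= b -> c <= c' -> d' <= d ->
  rect_in a' b' c' d' `<=` rect_in a b c d.
Proof.
move=> h1 h2 h3 h4 z [/andP[za zb] /andP[zc zd]]; split; apply/andP; split.
- exact: le_trans za.
- exact: le_trans h2.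
- exact: le_trans zc.
- exact: le_trans h4.
Qed.

(** Rectangles are packed as pairs of intervals so that bisection can iterate
    on them. *)
Definition quarters (r : (R * R) * (R * R)) (s : (R * R) * (R * R)) :=
  let: ((a, b), (c, d)) := r in
  let m := (a + b) / 2 in let n := (c + d) / 2 in
  (s.1 = (a, m) \/ s.1 = (m, b)) /\ (s.2 = (c, n) \/ s.2 = (n, d)).

Definition rect_val (w : C -> C) (r : (R * R) * (R * R)) : C :=
  rect_int r.1.1 r.1.2 r.2.1 r.2.2 w.
Definition rect_pts (r : (R * R) * (R * R)) := rect_in r.1.1 r.1.2 r.2.1 r.2.2.
Definition rect_len (r : (R * R) * (R * R)) := (r.1.2 - r.1.1) + (r.2.2 - r.2.1).
Definition rect_ok (r : (R * R) * (R * R)) := r.1.1 <= r.1.2 /\ r.2.1 <= r.2.2.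

Lemma quarters_ok r s : rect_ok r -> quarters r s ->
  [/\ rect_ok s, rect_len s = rect_len r / 2,
     r.1.1 <= s.1.1 /\ s.1.2 <= r.1.2 & r.2.1 <= s.2.1 /\ s.2.2 <= r.2.2].
Proof.
case: r s => [[a b] [c d]] [[a' b'] [c' d']]; rewrite /rect_ok /rect_len /= => -[ab cd].
by move=> [[] [-> ->] [] [-> ->]]; split; (try split); lra.
Qed.

(** The square of the perimeter is the sum of those of the four quarters, so
    that a bound proportional to it on each quarter would pass to the whole. *)
Lemma quarters_bad w (e : R) r : rect_ok r -> holomorphic_in (rect_pts r) w ->
  e * rect_len r ^+ 2 < normc (rect_val w r) ->
  exists2 s, quarters r s & e * rect_len s ^+ 2 < normc (rect_val w s).
Proof.
move=> rr hw bad; apply: contrapT => noq.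
have hq s : quarters r s -> normc (rect_val w s) <= e * (rect_len r / 2) ^+ 2.
  move=> qs; rewrite leNgt; apply/negP => h; apply: noq; exists s => //.
  by have [_ -> _ _] := quarters_ok rr qs.
have hwq s : quarters r s -> cont_on (rect_bd s.1.1 s.1.2 s.2.1 s.2.2) w.
  move=> qs z zs; apply: (holo_cont_on hw).
  have [[s1 s2] _ [h1 h2] [h3 h4]] := quarters_ok rr qs.
  by apply: (rect_inS h1 h2 h3 h4); exact: rect_bd_in zs.
case: r rr hw bad noq hq hwq => [[a b] [c d]] [ab cd] hw bad _ hq hwq.
have {}ab : a <= b := ab; have {}cd : c <= d := cd.
have {}hq p q : (p = _ \/ p = _) -> (q = _ \/ q = _) -> normc _ <= _ :=
  fun h1 h2 => hq (p, q) (conj h1 h2).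
have {}hwq p q : (p = _ \/ p = _) -> (q = _ \/ q = _) -> cont_on _ w :=
  fun h1 h2 => hwq (p, q) (conj h1 h2).
set m := (a + b) / 2 in hq hwq; set n := (c + d) / 2 in hq hwq.
have amb : a <= m <= b by rewrite /m; apply/andP; split; lra.
have cnd : c <= n <= d by rewrite /n; apply/andP; split; lra.
have E1 := rect_int_splity (proj1 (andP amb)) cnd
  (hwq (a,m) (c,n) (or_introl erefl) (or_introl erefl))
  (hwq (a,m) (n,d) (or_introl erefl) (or_intror erefl)).
have E2 := rect_int_splity (proj2 (andP amb)) cnd
  (hwq (m,b) (c,n) (or_intror erefl) (or_introl erefl))
  (hwq (m,b) (n,d) (or_intror erefl) (or_intror erefl)).
have cw := holo_cont_on hw.
have sub1 : rect_in a m c d `<=` rect_in a b c d.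
  by apply: rect_inS => //; case/andP: amb.
have sub2 : rect_in m b c d `<=` rect_in a b c d.
  by apply: rect_inS => //; case/andP: amb.
have E3 : rect_int a b c d w = rect_int a m c d w + rect_int m b c d w.
  apply: rect_int_splitx => // z /rect_bd_in.
    by move=> /(_ (proj1 (andP amb)) cd) /sub1 /cw.
  by move=> /(_ (proj2 (andP amb)) cd) /sub2 /cw.
have := hq (a,m) (c,n) (or_introl erefl) (or_introl erefl).
have := hq (a,m) (n,d) (or_introl erefl) (or_intror erefl).
have := hq (m,b) (c,n) (or_intror erefl) (or_introl erefl).
have := hq (m,b) (n,d) (or_intror erefl) (or_intror erefl).
move: bad; rewrite /rect_val /= E3 E1 E2 => bad h1 h2 h3 h4.
have := le_trans (normcD _ _) (lerD (le_trans (normcD _ _) (lerD h4 h3))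
  (le_trans (normcD _ _) (lerD h2 h1))).
rewrite leNgt => /negP; apply; apply: le_lt_trans bad.
by rewrite le_eqVlt; apply/orP; left; apply/eqP; field.
Qed.

Lemma nested_rects (r : nat -> (R * R) * (R * R)) :
  (forall n, rect_ok (r n)) ->
  (forall n, [/\ (r n).1.1 <= (r n.+1).1.1, (r n.+1).1.2 <= (r n).1.2,
    (r n).2.1 <= (r n.+1).2.1 & (r n.+1).2.2 <= (r n).2.2]) ->
  exists z : C, forall n, rect_pts (r n) z.
Proof.
move=> ok mono.
have nested (p q : nat -> R) : (forall n, p n <= q n) ->
    (forall n, p n <= p n.+1) -> (forall n, q n.+1 <= q n) ->
    exists x, forall n, p n <= x <= q n.
  move=> pq pS qS.
  have pm m n : (m <= n)%N -> p m <= p n by exact: (nondecreasing_seqP p).1.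
  have qm m n : (m <= n)%N -> q n <= q m by exact: (nonincreasing_seqP q).1.
  have pqmn m n : p m <= q n.
    apply: le_trans (pm _ _ (leq_maxl m n)) _.
    exact: le_trans (pq _) (qm _ _ (leq_maxr m n)).
  exists (sup (range p)) => n; apply/andP; split.
    apply: ub_le_sup; last by exists n.
    by exists (q 0%N) => _ [m _ <-].
  apply: ge_sup; first by exists (p 0%N), 0%N.
  by move=> _ [m _ <-].
have [x hx] := nested (fun n => (r n).1.1) (fun n => (r n).1.2)
  (fun n => proj1 (ok n)) (fun n => let: And4 h _ _ _ := mono n in h)
  (fun n => let: And4 _ h _ _ := mono n in h).
have [y hy] := nested (fun n => (r n).2.1) (fun n => (r n).2.2)
  (fun n => proj2 (ok n)) (fun n => let: And4 _ _ h _ := mono n in h)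
  (fun n => let: And4 _ _ _ h := mono n in h).
by exists (x +i* y) => n; split; [exact: hx|exact: hy].
Qed.

Lemma half_pow_lt (l e : R) : 0 < e -> exists n : nat, l / 2 ^+ n < e.
Proof.
move=> e0; have [n hn] : exists n : nat, l / e < n%:R.
  exists (Num.bound `|l / e|); apply: le_lt_trans (ler_norm _) _.
  by apply: archi_boundP; exact: normr_ge0.
exists n; rewrite ltr_pdivrMr ?exprn_gt0 // -ltr_pdivrMl // mulrC.
apply: lt_le_trans hn _; rewrite -natrX ler_nat.
by rewrite ltnW // ltn_expl.
Qed.

Lemma rect_pts_dist r (z t : C) :
  rect_pts r z -> rect_pts r t -> normc (t - z) <= rect_len r.
Proof.
case: r z t => [[a b] [c d]] [x y] [x' y']; rewrite /rect_pts /rect_in /rect_len /=.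
move=> [/andP[h1 h2] /andP[h3 h4]] [/andP[h5 h6] /andP[h7 h8]].
apply: le_trans (normc_le_ReIm _) _ => /=.
by apply: lerD; rewrite ler_norml; apply/andP; split; lra.
Qed.

(** Bisection: a rectangle carrying too large an integral contains smaller and
    smaller such rectangles, which contradicts the first-order expansion of [w]
    at their common point, because affine functions integrate to 0. *)
Lemma goursat_rect a b c d w : a <= b -> c <= d ->
  holomorphic_in (rect_in a b c d) w -> rect_int a b c d w = 0.
Proof.
move=> ab cd hw; apply/eqP; rewrite -normc_eq0; apply: contrapT => /negP N0.
set r0 := ((a, b), (c, d)).
have N_gt0 : 0 < normc (rect_val w r0) by rewrite lt_def N0 normc_ge0.
(* The summand 1 keeps e meaningful for a degenerate rectangle. *)
pose e := normc (rect_val w r0) / (rect_len r0 ^+ 2 + 1).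
have l1_gt0 : 0 < rect_len r0 ^+ 2 + 1 by rewrite ltr_wpDl // sqr_ge0.
have e0 : 0 < e by rewrite divr_gt0.
pose Q r := [/\ rect_ok r, rect_pts r `<=` rect_pts r0 &
  e * rect_len r ^+ 2 < normc (rect_val w r)].
have Q0 : Q r0.
  split=> //; rewrite /e mulrAC ltr_pdivrMr //.
  by rewrite ltr_pM2l // ltrDl.
have step r : exists s, Q r -> quarters r s /\ Q s.
  have [Qr|nQr] := pselect (Q r); last by exists r.
  have [okr rr0 bad] := Qr.
  have hwr : holomorphic_in (rect_pts r) w by move=> z /rr0; exact: hw.
  have [s qs bads] := quarters_bad okr hwr bad; exists s => _; split=> //.
  have [oks _ [h1 h2] [h3 h4]] := quarters_ok okr qs.
  by split=> // z zs; apply: rr0; apply: (rect_inS h1 h2 h3 h4).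
have [nx hnx] := choice step.
pose r n := iter n nx r0.
have Qr n : Q (r n) by elim: n => // n /hnx[].
have qr n : quarters (r n) (r n.+1) by have [] := hnx _ (Qr n).
have okr n : rect_ok (r n) by have [] := Qr n.
have lr n : rect_len (r n) = rect_len r0 / 2 ^+ n.
  elim: n => [|n IH]; first by rewrite expr0 divr1.
  have [_ -> _ _] := quarters_ok (okr n) (qr n).
  by rewrite IH exprSr invfM mulrA.
have [z hz] : exists z : C, forall n, rect_pts (r n) z.
  apply: nested_rects => // n.
  by have [_ _ [? ?] [? ?]] := quarters_ok (okr n) (qr n).
have [c0 /(_ (e / 4)) hc] := (differentiableCP w z).1 (hw z (hz 0%N)).
have [|del del0 hdel] := hc; first by rewrite divr_gt0.
have [n hn] := half_pow_lt (rect_len r0) del0.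
have [_ rr0 bad] := Qr n.
have {bad}bad : e * rect_len (r n) ^+ 2 < normc (rect_val w (r n)) := bad.
have {okr}[ok1 ok2] := okr n.
set s := r n in rr0 bad ok1 ok2.
have hws : cont_on (rect_bd s.1.1 s.1.2 s.2.1 s.2.2) w.
  move=> t /(rect_bd_in ok1 ok2) /rr0; exact: (holo_cont_on hw).
pose aff t := (w z - c0 * z) + c0 * t.
have haff : cont_on (rect_bd s.1.1 s.1.2 s.2.1 s.2.2) aff.
  move=> t _; apply: continuousD_at; first exact: cst_continuous.
  by apply: continuousZ_at; exact: cvg_id.
(* Subtracting the affine part leaves the integral unchanged. *)
have E : rect_val w s = rect_int s.1.1 s.1.2 s.2.1 s.2.2 (fun t => w t - aff t).
  by rewrite (rect_intB hws haff) (rect_int_affine ok1 ok2) subr0.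
have B : normc (rect_val w s) <= 4 * (e / 4 * rect_len s) * rect_len s.
  rewrite E; apply: rect_int_le; [exact: ok1|exact: ok2| |].
    move=> t st; have -> : (fun t => w t - aff t) = (fun t => w t + (-1) * aff t).
      by apply/funext => x; rewrite mulN1r.
    apply: continuousD_at; first exact: hws.
    by apply: continuousZ_at; exact: haff.
  move=> t /(rect_bd_in ok1 ok2) st.
  have dt : normc (t - z) <= rect_len s := rect_pts_dist (hz n) st.
  have -> : w t - aff t = w (z + (t - z)) - w z - c0 * (t - z).
    by rewrite [z + _]addrC subrK /aff; ring.
  apply: le_trans (hdel _ _) _; first by apply: le_lt_trans dt _; rewrite lr.
  by rewrite ler_pM2l ?divr_gt0.
move: (lt_le_trans bad B); rewrite (_ : 4 * _ * _ = e * rect_len s ^+ 2) ?ltxx //.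
by field.
Qed.

End Goursat.

(** * Cauchy's formula and Taylor expansions on a square *)

Section Cauchy.
Local Open Scope complex_scope.
Variable R : realType.
Local Notation C := R[i].
Implicit Types (v w F : C -> C) (a b c d S M : R) (z t : C).

Lemma rect_int_eq a b c d v w : a <= b -> c <= d ->
  cont_on (rect_bd a b c d) v -> cont_on (rect_bd a b c d) w ->
  (forall z, rect_bd a b c d z -> v z = w z) ->
  rect_int a b c d v = rect_int a b c d w.
Proof.
move=> ab cd cv cw vw; apply/eqP; rewrite -subr_eq0 -(rect_intB cv cw) -normc_eq0.
rewrite eq_le normc_ge0 andbT.
have -> : 0 = 4 * 0 * ((b - a) + (d - c)) by rewrite mulr0 mul0r.
apply: rect_int_le; [exact: ab|exact: cd| |].
  have -> : (fun z => v z - w z) = (fun z => v z + (-1) * w z).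
    by apply/funext => x; rewrite mulN1r.
  by apply: cont_onD; [exact: cv|exact: (@cont_onZ _ _ (-1) _ cw)].
by move=> z /vw ->; rewrite subrr normc0.
Qed.

(** Prolonging the sides of the hole cuts off four rectangles on which [w] is
    holomorphic. *)
Lemma rect_int_shrink a b c d a' b' c' d' w :
  a <= a' -> a' <= b' -> b' <= b -> c <= c' -> c' <= d' -> d' <= d ->
  (forall z, rect_in a b c d z ->
    ~ (a' < complex.Re z < b' /\ c' < complex.Im z < d') -> differentiable w z) ->
  rect_int a b c d w = rect_int a' b' c' d' w.
Proof.
move=> aa ab bb cc cd dd hw.
have acd : c <= d by rewrite (le_trans cc) // (le_trans cd).
have goodrect p q r s : a <= p -> q <= b -> c <= r -> s <= d ->
    q <= a' \/ b' <= p \/ s <= c' \/ d' <= r ->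
    holomorphic_in (rect_in p q r s) w.
  move=> h1 h2 h3 h4 h5 z zr; apply: hw; first exact: (rect_inS h1 h2 h3 h4).
  case: zr => /andP[z1 z2] /andP[z3 z4] [/andP[z5 z6] /andP[z7 z8]].
  by case: h5 => [|[|[|]]]; lra.
have bdc p q r s : a <= p -> p <= q -> q <= b -> c <= r -> r <= s -> s <= d ->
    (p <= a' \/ b' <= p) -> (q <= a' \/ b' <= q) ->
    (r <= c' \/ d' <= r) -> (s <= c' \/ d' <= s) ->
    cont_on (rect_bd p q r s) w.
  move=> h1 h2 h3 h4 h5 h6 k1 k2 k3 k4 z zb; apply: differentiable_continuous.
  apply: hw; first by apply: (rect_inS h1 h3 h4 h6); exact: rect_bd_in zb.
  case=> /andP[z5 z6] /andP[z7 z8].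
  case: zb => -[/andP[z1 z2] [] e]; rewrite e in z5 z6 z7 z8; lra.
rewrite (@rect_int_splitx R a a' b c d); first last.
- by apply: bdc => //; lra.
- by apply: bdc => //; lra.
- exact: acd.
- by apply/andP; split; lra.
rewrite (@goursat_rect R a a' c d w) ?add0r //; last by apply: goodrect => //; lra.
rewrite (@rect_int_splitx R a' b' b c d); first last.
- by apply: bdc => //; lra.
- by apply: bdc => //; lra.
- exact: acd.
- by apply/andP; split; lra.
rewrite (@goursat_rect R b' b c d w) ?addr0 //; last by apply: goodrect => //; lra.
rewrite (@rect_int_splity R a' b' c c' d); first last.
- by apply: bdc => //; lra.
- by apply: bdc => //; lra.
- by apply/andP; split; lra.
- exact: ab.
rewrite (@goursat_rect R a' b' c c' w) ?add0r //; last by apply: goodrect => //; lra.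
rewrite (@rect_int_splity R a' b' c' d' d); first last.
- by apply: bdc => //; lra.
- by apply: bdc => //; lra.
- by apply/andP; split; lra.
- exact: ab.
by rewrite (@goursat_rect R a' b' d' d w) ?addr0 //; apply: goodrect => //; lra.
Qed.

Local Notation Q S := (rect_in (- S) S (- S) S).
Local Notation bdQ S := (rect_bd (- S) S (- S) S).
Local Notation sq S := (rect_int (- S) S (- S) S).

Lemma bdQ_norm S z : bdQ S z -> S <= normc z.
Proof.
move=> zb; have [S0|S0] := leP 0 S; last by rewrite (le_trans (ltW S0)) ?normc_ge0.
have hS x : x = - S \/ x = S -> S <= `|x|.
  by case=> ->; rewrite ?normrN ger0_norm.
case: zb => -[_ /hS h]; apply: (le_trans h); first exact: Im_le_normc.
exact: Re_le_normc.
Qed.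

(** The integral is the same along all larger squares, and quadratic decay makes
    it tend to 0. *)
Lemma cauchy_decay w K : 0 <= K ->
  (forall z, 1 <= normc z -> differentiable w z) ->
  (forall z, 1 <= normc z -> normc (w z) <= K / normc z ^+ 2) ->
  sq 1 w = 0.
Proof.
move=> K0 hw hK.
have hS S : 1 <= S -> sq 1 w = sq S w.
  move=> S1; apply/esym; apply: rect_int_shrink; [lra|lra|lra|lra|lra|lra|].
  move=> z _ nz; apply: hw; rewrite leNgt; apply/negP => z1; apply: nz.
  have := le_lt_trans (Re_le_normc z) z1; have := le_lt_trans (Im_le_normc z) z1.
  by rewrite !ltr_norml.
have bound S : 1 <= S -> normc (sq 1 w) <= 16 * K / S.
  move=> S1; rewrite (hS S S1).
  have S0 : 0 < S by lra.
  have : normc (sq S w) <= 4 * (K / S ^+ 2) * ((S - - S) + (S - - S)).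
    apply: rect_int_le; [lra|lra| |].
      move=> z /bdQ_norm zS; apply: differentiable_continuous; apply: hw; lra.
    move=> z /bdQ_norm zS; apply: le_trans (hK _ _) _; first lra.
    rewrite ler_wpM2l // lef_pV2 ?posrE ?exprn_gt0 //; last lra.
    by rewrite lerXn2r // ?nnegrE; lra.
  by move=> h; apply: (le_trans h); rewrite le_eqVlt; apply/orP; left; apply/eqP;
    field; rewrite gt_eqF.
apply/eqP; rewrite -normc_eq0; apply: contrapT => /negP n0.
have N0 : 0 < normc (sq 1 w) by rewrite lt_def n0 normc_ge0.
set N := normc _ in N0 bound.
have := bound (1 + 16 * K / N + 1) _.
have K16 : 0 <= 16 * K / N by rewrite divr_ge0 ?(ltW N0) //; lra.
set T := 1 + _ + 1 => h; have T1 : 1 <= T by rewrite /T; lra.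
have {h} := h T1; rewrite ler_pdivlMr; last by lra.
have -> : N * T = 2 * N + 16 * K by rewrite /T; field; rewrite gt_eqF.
lra.
Qed.

Lemma differentiable_inv_sub (p t : C) : t != p ->
  differentiable (fun z : C => (z - p)^-1) t.
Proof.
move=> tp; apply: (@differentiableV C C (fun z => z - p) t).
  apply: (@differentiableB C C C id (fun=> p)).
    by apply/derivable1_diffP; exact: derivable_id.
  exact: differentiable_cst.
by rewrite subr_eq0.
Qed.

Lemma differentiable_mul (f g : C -> C) t : differentiable f t ->
  differentiable g t -> differentiable (fun z => f z * g z) t.
Proof. by move=> hf hg; exact: (@differentiableM C C f g t hf hg). Qed.

Lemma differentiable_exp n (t : C) : differentiable (fun z : C => z ^+ n) t.
Proof.
elim: n => [|n IH].
  have -> : (fun z : C => z ^+ 0) = (fun=> 1) by apply/funext => z; rewrite expr0.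
  exact: differentiable_cst.
have -> : (fun z : C => z ^+ n.+1) = (fun z => z * z ^+ n).
  by apply/funext => z; rewrite exprS.
by apply: differentiable_mul => //; apply/derivable1_diffP; exact: derivable_id.
Qed.

(** This is 2 pi i; dividing by it calls for a lower bound on its modulus. *)
Definition kappa : C := sq 1 (fun z => z^-1).

Lemma Im_kappa : 4 <= complex.Im kappa.
Proof.
have N11 : (-1 : R) <= 1 by lra.
pose g := fun x : R => 2 / (1 + x ^+ 2).
have x2 (x : R) : 1 + x ^+ 2 != 0 by rewrite gt_eqF // ltr_pwDl // sqr_ge0.
have N2 : (- 1 : R) ^+ 2 = 1 by rewrite sqrrN expr1n.
have E1 : (fun x : R => (x +i* -1 : C)^-1 - (x +i* 1)^-1) = (fun x => 0 +i* g x).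
  apply/funext => x; rewrite /GRing.inv /= N2 expr1n; congr (_ +i* _).
    by rewrite subrr.
  by rewrite /g [x ^+ 2 + 1]addrC; field.
have E2 : (fun y : R => (1 +i* y : C)^-1 - (-1 +i* y)^-1) = (fun x => g x +i* 0).
  apply/funext => x; rewrite /GRing.inv /= N2 expr1n; congr (_ +i* _).
    by rewrite /g; field.
  by rewrite subrr.
have cg : cont_itv (-1) 1 g.
  move=> x _; apply: (@continuousM R R (fun=> 2)); first exact: cst_continuous.
  apply: continuousV; first exact: x2.
  apply: (@continuousD R R R (fun=> 1)); first exact: cst_continuous.
  exact: exprn_continuous.
have I2 : 2 <= intg (-1) 1 g.
  have -> : (2 : R) = intg (-1) 1 (fun=> 1) by rewrite intg_cst //; ring.
  apply: le_intg; [by move=> x _; exact: cst_continuous|exact: cg|].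
  move=> x /andP[x1 x3]; rewrite /g ler_pdivlMr; last first.
    by rewrite ltr_pwDl // sqr_ge0.
  rewrite mul1r; nra.
rewrite /kappa /rect_int E1 E2 /cintg /=.
by rewrite mul0r add0r mul1r; lra.
Qed.

Lemma normc_kappa : 4 <= normc kappa.
Proof.
by apply: le_trans Im_kappa _; apply: le_trans (Im_le_normc _); exact: ler_norm.
Qed.

(** The difference of the two kernels decays quadratically. *)
Lemma kappa_shift z : normc z <= 1 / 2 -> sq 1 (fun t => (t - z)^-1) = kappa.
Proof.
move=> z2.
have nz p t : normc p <= 1 / 2 -> 1 <= normc t -> normc t / 2 <= normc (t - p).
  move=> p2 t1; have := normcD (t - p) p; rewrite subrK; lra.
have nz0 p t : normc p <= 1 / 2 -> 1 <= normc t -> t != p.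
  move=> p2 t1; apply/negP => /eqP E; move: p2 t1; rewrite E; lra.
have n0 : normc (0 : C) <= 1 / 2 by rewrite normc0; lra.
have dv p : normc p <= 1 / 2 -> cont_on (bdQ 1) (fun t => (t - p)^-1).
  move=> p2 t /bdQ_norm t1; apply: differentiable_continuous.
  by apply: differentiable_inv_sub; exact: (nz0 p t p2 t1).
have -> : kappa = sq 1 (fun t => (t - 0)^-1).
  by congr rect_int; apply/funext => t; rewrite subr0.
have N11 : (-1 : R) <= 1 by lra.
apply/eqP; rewrite -subr_eq0 -(rect_intB (dv z z2) (dv 0 n0)); apply/eqP.
apply: (@cauchy_decay _ (2 * normc z)); first by rewrite mulr_ge0 ?normc_ge0.
  move=> t t1; apply: (@differentiableB C C C (fun t => (t - z)^-1)).
    by apply: differentiable_inv_sub; exact: (nz0 z t z2 t1).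
  by apply: differentiable_inv_sub; exact: (nz0 0 t n0 t1).
move=> t t1; have tz := nz0 z t z2 t1; have t0 := nz0 0 t n0 t1.
have -> : (t - z)^-1 - (t - 0)^-1 = z / (t * (t - z)).
  by field; rewrite t0 subr_eq0 tz.
have T0 : 0 < normc t by lra.
rewrite normcM normcV normcM (_ : 2 * _ / _ = normc z / (normc t * (normc t / 2))).
  have Tz : 0 < normc (t - z) by rewrite normc_gt0 subr_eq0.
  apply: ler_wpM2l; first exact: normc_ge0.
  rewrite lef_pV2 ?posrE; [|exact: mulr_gt0|by apply: mulr_gt0; lra].
  by rewrite ler_pM2l //; exact: (nz z t z2 t1).
by field; rewrite gt_eqF.
Qed.

(** The difference quotient of [F] is bounded near [z], so that its integral
    around small squares centred at [z] vanishes in the limit. *)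
Lemma cauchy_formula F z : holomorphic_in (Q 1) F -> normc z <= 1 / 2 ->
  sq 1 (fun t => F t / (t - z)) = F z * kappa.
Proof.
move=> hF z2.
have zR := le_trans (Re_le_normc z) z2; have zI := le_trans (Im_le_normc z) z2.
rewrite !ler_norml in zR zI.
have Qz : Q 1 z by split; lra.
have N11 : (-1 : R) <= 1 by lra.
have bdz t : bdQ 1 t -> t != z.
  move=> /bdQ_norm t1; apply/negP => /eqP E; move: z2 t1; rewrite E; lra.
have bdQ1 : bdQ 1 `<=` Q 1 := rect_bd_in N11 N11.
have dv : cont_on (bdQ 1) (fun t => (t - z)^-1).
  move=> t /bdz tz; apply: differentiable_continuous.
  exact: differentiable_inv_sub.
have dF : cont_on (bdQ 1) (fun t => F t / (t - z)).
  move=> t tb; apply: differentiable_continuous; apply: differentiable_mul.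
    by apply: hF; exact: bdQ1.
  by apply: differentiable_inv_sub; exact: bdz.
rewrite -(kappa_shift z2) -(rect_intZ _ dv).
apply/eqP; rewrite -subr_eq0 -(rect_intB dF (@cont_onZ _ _ (F z) _ dv)); apply/eqP.
set w := fun t => _ - _.
have hw t : Q 1 t -> t != z -> differentiable w t.
  move=> Qt tz; apply: (@differentiableB C C C (fun t => F t / (t - z))).
    by apply: differentiable_mul; [exact: hF|exact: differentiable_inv_sub].
  apply: differentiable_mul; first exact: differentiable_cst.
  exact: differentiable_inv_sub.
have [c0 /(_ 1 ltr01)[del del0 hdel]] := (differentiableCP F z).1 (hF z Qz).
set M := normc c0 + 1.
have M0 : 0 <= M by rewrite addr_ge0 ?normc_ge0.
have wM t : normc (t - z) < del -> normc (w t) <= M.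
  move=> tz; have [->|t0] := eqVneq t z.
    by rewrite /w subrr normc0.
  have tz0 : t - z != 0 by rewrite subr_eq0.
  have -> : w t = (F t - F z) / (t - z) by rewrite /w mulrBl.
  rewrite normcM normcV ler_pdivrMr ?normc_gt0 //.
  have := hdel _ tz; rewrite [z + _]addrC subrK => h.
  have -> : F t - F z = (F t - F z - c0 * (t - z)) + c0 * (t - z) by rewrite subrK.
  apply: le_trans (normcD _ _) _; rewrite normcM /M mulrDl addrC lerD2l.
  exact: h.
(* Shrink the contour to a square of half-side s centred at z. *)
have bound s : 0 < s -> s <= 1 / 2 -> s < del / 2 -> normc (sq 1 w) <= 16 * M * s.
  move=> s0 s1 sdel.
  rewrite (_ : sq 1 w = rect_int (complex.Re z - s) (complex.Re z + s)
    (complex.Im z - s) (complex.Im z + s) w); last first.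
    apply: rect_int_shrink; [lra|lra|lra|lra|lra|lra|].
    move=> t Qt nt; apply: (hw t Qt); apply/negP => /eqP E; apply: nt.
    by rewrite E; split; lra.
  have -> : 16 * M * s = 4 * M * ((complex.Re z + s - (complex.Re z - s)) +
    (complex.Im z + s - (complex.Im z - s))) by ring.
  have sub t : rect_bd (complex.Re z - s) (complex.Re z + s)
    (complex.Im z - s) (complex.Im z + s) t -> Q 1 t /\ t != z.
    move=> tb; split.
      apply: (@rect_inS _ (- 1) 1 (- 1) 1 (complex.Re z - s) (complex.Re z + s)
        (complex.Im z - s) (complex.Im z + s)); [lra|lra|lra|lra|].
      by apply: rect_bd_in; [lra|lra|exact: tb].
    apply/negP => /eqP E; rewrite E in tb.
    by case: tb => -[_ [] e]; lra.
  apply: rect_int_le; [lra|lra| |].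
    by move=> t /sub[Qt tz]; apply: differentiable_continuous; exact: hw.
  move=> t tb; apply: wM.
  have : rect_in (complex.Re z - s) (complex.Re z + s)
    (complex.Im z - s) (complex.Im z + s) t by apply: rect_bd_in; [lra|lra|].
  case: (t) => x y; case: (z) => p q; rewrite /rect_in /= => -[xs ys].
  apply: le_lt_trans (normc_le_ReIm _) _ => /=.
  have : `|x - p| <= s by rewrite ler_norml; lra.
  have : `|y - q| <= s by rewrite ler_norml; lra.
  lra.
apply/eqP; rewrite -normc_eq0; apply: contrapT => /negP n0.
have N0 : 0 < normc (sq 1 w) by rewrite lt_def n0 normc_ge0.
set N := normc _ in N0 bound.
have M1 : 0 < 16 * M + 1 by lra.
pose s := Num.min (Num.min (1 / 2) (del / 4)) (N / (16 * M + 1) ).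
have s1 : s <= 1 / 2 by rewrite /s !ge_min lexx.
have s2 : s <= del / 4 by rewrite /s !ge_min lexx !orbT.
have s3 : s <= N / (16 * M + 1) by rewrite /s !ge_min lexx !orbT.
have s0 : 0 < s.
  rewrite /s !lt_min divr_gt0 //= ?divr_gt0 //.
have := bound s s0 s1; have sd : s < del / 2 by lra.
move=> /(_ sd); move: s3; rewrite ler_pdivlMr // => s3 h.
have : s * (16 * M + 1) = 16 * M * s + s by ring.
lra.
Qed.

(** Insert 1/(t - z) = 1/t + z/t^2 + z^2/t^3 + z^3/(t^3 (t - z)) into
    Cauchy's formula. *)
Lemma taylor_unit F M : holomorphic_in (Q 1) F ->
  (forall z, Q 1 z -> normc (F z) <= M) ->
  exists p q : C, normc q <= 4 * M /\
    forall z, normc z <= 1 / 2 ->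
      normc (F z - (F 0 + p * z + q * z ^+ 2)) <= 8 * M * normc z ^+ 3.
Proof.
move=> hF hM.
have N11 : (-1 : R) <= 1 by lra.
have bdQ1 : bdQ 1 `<=` Q 1 := rect_bd_in N11 N11.
have M0 : 0 <= M.
  by apply: le_trans (normc_ge0 _) (hM 0 _); split=> /=; lra.
have k4 := normc_kappa.
have k0 : kappa != 0 by rewrite -normc_gt0; lra.
have bd0 t : bdQ 1 t -> t != 0.
  move=> /bdQ_norm t1; rewrite -normc_gt0; lra.
have cF n : cont_on (bdQ 1) (fun t => F t / t ^+ n).
  move=> t tb; apply: differentiable_continuous; apply: differentiable_mul.
    by apply: hF; exact: bdQ1.
  apply: (@differentiableV C C (fun t => t ^+ n)); last by rewrite expf_neq0 // bd0.
  exact: differentiable_exp.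
pose c n := sq 1 (fun t => F t / t ^+ n).
have cM n : normc (c n) <= 16 * M.
  have -> : 16 * M = 4 * M * ((1 - - 1) + (1 - - 1)) by ring.
  apply: (rect_int_le N11 N11 (cF n)) => t tb.
  rewrite normcM normcV normcX -[leRHS]mulr1 ler_pM ?normc_ge0 //.
  - by rewrite invr_ge0 exprn_ge0 // normc_ge0.
  - by apply: hM; exact: bdQ1.
  - by rewrite invf_le1 ?exprn_gt0 ?exprn_ege1 //; have := bdQ_norm tb; lra.
exists (c 2%N / kappa), (c 3%N / kappa); split.
  rewrite normcM normcV ler_pdivrMr; last lra.
  by apply: le_trans (cM 3%N) _; nra.
move=> z z2.
have bdz t : bdQ 1 t -> 1 / 2 <= normc (t - z).
  move=> /bdQ_norm t1; have := normcD (t - z) z; rewrite subrK; lra.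
have bdz0 t : bdQ 1 t -> t != z.
  by move=> /bdz h; rewrite -subr_eq0 -normc_gt0; lra.
have E0 : F 0 * kappa = c 1%N.
  have n02 : normc (0 : C) <= 1 / 2 by rewrite normc0; lra.
  rewrite -(cauchy_formula hF n02).
  by congr rect_int; apply/funext => t; rewrite subr0 expr1.
pose r := fun t => F t / (t ^+ 3 * (t - z)).
have cr : cont_on (bdQ 1) r.
  move=> t tb; apply: differentiable_continuous; apply: differentiable_mul.
    by apply: hF; exact: bdQ1.
  apply: (@differentiableV C C (fun t => t ^+ 3 * (t - z))); last first.
    apply: mulf_neq0; first by rewrite expf_neq0 // bd0.
    by rewrite subr_eq0 bdz0.
  apply: differentiable_mul.
    exact: differentiable_exp.
  apply: (@differentiableB C C C id (fun=> z)).
    by apply/derivable1_diffP; exact: derivable_id.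
  exact: differentiable_cst.
have cc := cont_onD (cont_onD (cF 1%N) (@cont_onZ _ _ z _ (cF 2%N)))
  (@cont_onZ _ _ (z ^+ 2) _ (cF 3%N)).
have dFz : cont_on (bdQ 1) (fun t => F t / (t - z)).
  move=> t tb; apply: differentiable_continuous; apply: differentiable_mul.
    by apply: hF; exact: bdQ1.
  by apply: differentiable_inv_sub; exact: bdz0.
have E : F z * kappa = c 1%N + z * c 2%N + z ^+ 2 * c 3%N + z ^+ 3 * sq 1 r.
  rewrite -(cauchy_formula hF z2) /c.
  rewrite -(rect_intZ z (cF 2%N)) -(rect_intZ (z ^+ 2) (cF 3%N)) -(rect_intZ (z ^+ 3) cr).
  rewrite -(rect_intD (cF 1%N) (@cont_onZ _ _ z _ (cF 2%N))).
  rewrite -(rect_intD (cont_onD (cF 1%N) (@cont_onZ _ _ z _ (cF 2%N)))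
    (@cont_onZ _ _ (z ^+ 2) _ (cF 3%N))).
  rewrite -(rect_intD cc (@cont_onZ _ _ (z ^+ 3) _ cr)).
  apply: (rect_int_eq N11 N11 dFz).
    apply: cont_onD; first exact: cc.
    exact: (@cont_onZ _ _ (z ^+ 3) _ cr).
  move=> t tb; rewrite /r; field.
  by rewrite subr_eq0 bdz0 // bd0.
have Er : normc (sq 1 r) <= 32 * M.
  have -> : 32 * M = 4 * (2 * M) * ((1 - - 1) + (1 - - 1)) by ring.
  apply: (rect_int_le N11 N11 cr) => t tb.
  rewrite /r normcM normcV normcM normcX mulrC.
  have t1 := bdQ_norm tb; have t2 := bdz t tb.
  have h : 1 / 2 <= normc t ^+ 3 * normc (t - z).
    rewrite -[leLHS]mul1r; apply: ler_pM; [lra|lra|exact: exprn_ege1|exact: t2].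
  have h0 : 0 < normc t ^+ 3 * normc (t - z) by lra.
  apply: ler_pM; rewrite ?normc_ge0 ?invr_ge0 ?(ltW h0) //.
    by rewrite -(ler_pM2r h0) mulVf ?gt_eqF //; lra.
  by apply: hM; exact: bdQ1.
have -> : F z - (F 0 + c 2%N / kappa * z + c 3%N / kappa * z ^+ 2) =
    z ^+ 3 * sq 1 r / kappa.
  apply: (mulIf k0); rewrite mulrBl E; move: E0.
  move: (c 1%N) (c 2%N) (c 3%N) (sq 1 r) => c1 c2 c3 s E0.
  by rewrite !mulrDl E0; field.
rewrite normcM normcV normcM normcX ler_pdivrMr; last lra.
have z30 : 0 <= normc z ^+ 3 by rewrite exprn_ge0 // normc_ge0.
apply: (@le_trans _ _ (normc z ^+ 3 * (32 * M))); first by rewrite ler_wpM2l.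
have : 0 <= M * normc z ^+ 3 by rewrite mulr_ge0.
set X := normc z ^+ 3; nra.
Qed.

End Cauchy.

(** * Local behaviour of holomorphic functions *)

Section Consequences.
Local Open Scope complex_scope.
Variable R : realType.
Local Notation C := R[i].
Implicit Types (F w u : C -> C) (r e M : R) (z t : C).

Lemma differentiable_affine (a b t : C) : differentiable (fun z : C => a + b * z) t.
Proof.
apply: (@differentiableD C C C (fun=> a)); first exact: differentiable_cst.
apply: differentiable_mul; first exact: differentiable_cst.
by apply/derivable1_diffP; exact: derivable_id.
Qed.

Lemma taylor_disc F r M : 0 < r ->
  (forall z, normc z <= r -> differentiable F z) ->
  (forall z, normc z <= r -> normc (F z) <= M) ->
  exists p q : C, normc q <= 16 * M / r ^+ 2 /\
    forall z, normc z <= r / 4 ->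
      normc (F z - (F 0 + p * z + q * z ^+ 2)) <= 64 * M / r ^+ 3 * normc z ^+ 3.
Proof.
move=> r0 hF hM; pose s := r / 2; have s0 : 0 < s by rewrite /s; lra.
have sC : s%:C != 0 :> C by rewrite -normc_gt0 normc_real gtr0_norm.
have sub z : rect_in (- 1) 1 (- 1) 1 z -> normc (0 + s%:C * z) <= r.
  move=> [z1 z2]; rewrite add0r normcM normc_real gtr0_norm //.
  rewrite (_ : r = s * 2); last by rewrite /s; field.
  rewrite ler_pM2l //; apply: le_trans (normc_le_ReIm _) _.
  rewrite (_ : 2 = 1 + 1) //; apply: lerD; rewrite ler_norml; lra.
have [||p [q [hq hpq]]] := @taylor_unit R (fun z => F (0 + s%:C * z)) M.
- move=> z /sub zr.
  apply: (@differentiable_comp C C C C (fun z => 0 + s%:C * z) F).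
    exact: differentiable_affine.
  exact: hF.
- by move=> z /sub; exact: hM.
exists (p / s%:C), (q / s%:C ^+ 2); split.
  rewrite normcM normcV normcX normc_real gtr0_norm // ler_pdivrMr ?exprn_gt0 //.
  by apply: (le_trans hq); rewrite le_eqVlt; apply/orP; left; apply/eqP;
    rewrite /s; field; rewrite gt_eqF.
move=> z zr; have := hpq (z / s%:C).
rewrite normcM normcV normc_real gtr0_norm // ler_pdivrMr // mulr0 !add0r.
have -> : 1 / 2 * s = r / 4 by rewrite /s; field.
move=> /(_ zr); rewrite mulrC divfK //.
have -> : p * (z / s%:C) = p / s%:C * z by field.
have -> : q * (z / s%:C) ^+ 2 = q / s%:C ^+ 2 * z ^+ 2 by field.
move=> h; apply: (le_trans h); rewrite le_eqVlt; apply/orP; left; apply/eqP.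
by rewrite /s; field; rewrite gt_eqF.
Qed.

(** The dependence of the constant on [M] and [r] makes the estimate uniform
    over the complex lines through a point, as needed in several variables. *)
Lemma taylor1_disc F r M : 0 < r ->
  (forall z, normc z <= r -> differentiable F z) ->
  (forall z, normc z <= r -> normc (F z) <= M) ->
  exists p : C, forall z, normc z <= r / 4 ->
      normc (F z - (F 0 + p * z)) <= 32 * M / r ^+ 2 * normc z ^+ 2.
Proof.
move=> r0 hF hM; have [p [q [hq h]]] := taylor_disc r0 hF hM; exists p => z zr.
have M0 : 0 <= M.
  by apply: le_trans (normc_ge0 _) (hM 0 _); rewrite normc0 ltW.
have -> : F z - (F 0 + p * z) = (F z - (F 0 + p * z + q * z ^+ 2)) + q * z ^+ 2.
  by ring.
apply: le_trans (normcD _ _) _; rewrite normcM normcX.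
have z20 : 0 <= normc z ^+ 2 by rewrite exprn_ge0 ?normc_ge0.
have E : 32 * M / r ^+ 2 * normc z ^+ 2 =
    64 * M / r ^+ 3 * (normc z ^+ 2 * (r / 4)) + 16 * M / r ^+ 2 * normc z ^+ 2.
  by field; rewrite gt_eqF.
rewrite E; apply: lerD; last by rewrite ler_wpM2r.
apply: (le_trans (h z zr)); rewrite [normc z ^+ 3]exprSr.
apply: ler_wpM2l.
  by apply: divr_ge0; [apply: mulr_ge0|apply: exprn_ge0; apply: ltW].
by rewrite ler_wpM2l.
Qed.

Lemma taylor2_at F z : (\forall t \near z, differentiable F t) ->
  exists p q : C, exists K e : R, [/\ 0 <= K, 0 < e & forall t, normc t <= e ->
    normc (F (z + t) - (F z + p * t + q * t ^+ 2)) <= K * normc t ^+ 3].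
Proof.
move=> hF; have dFz := nbhs_singleton hF.
have [c /(_ 1 ltr01)[d2 d20 hd2]] := (differentiableCP F z).1 dFz.
move/nbhsC : hF => [d1 d10 hd1].
pose r := Num.min 1 (Num.min (d1 / 2) (d2 / 2)).
have r0 : 0 < r by rewrite /r !lt_min ltr01 !divr_gt0.
have r1 : r <= 1 by rewrite /r !ge_min lexx.
have r2 : r <= d1 / 2 by rewrite /r !ge_min lexx !orbT.
have r3 : r <= d2 / 2 by rewrite /r !ge_min lexx !orbT.
pose M := normc (F z) + (normc c + 1).
pose G t := F (z + 1 * t).
have hG t : normc t <= r -> differentiable G t.
  move=> tr; apply: (@differentiable_comp C C C C (fun t => z + 1 * t) F).
    exact: differentiable_affine.
  by apply: hd1; rewrite mul1r addrC addKr; lra.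
have GM t : normc t <= r -> normc (G t) <= M.
  move=> tr; rewrite /G mul1r.
  have -> : F (z + t) = F z + ((F (z + t) - F z - c * t) + c * t) by ring.
  apply: le_trans (normcD _ _) _; rewrite lerD2l.
  apply: le_trans (normcD _ _) _; rewrite normcM.
  have td2 : normc t < d2 by lra.
  have := hd2 t td2; rewrite mul1r.
  have := normc_ge0 c; have := normc_ge0 t; nra.
have M0 : 0 <= M by rewrite /M; have := normc_ge0 (F z); have := normc_ge0 c; lra.
have [p [q [_ hpq]]] := taylor_disc r0 hG GM.
exists p, q, (64 * M / r ^+ 3), (r / 4); split.
- by apply: divr_ge0; [apply: mulr_ge0|apply: exprn_ge0; apply: ltW].
- by rewrite divr_gt0.
- by move=> t /hpq; rewrite /G !mul1r addr0.
Qed.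

(** The function t w(t) is holomorphic, and its second-order expansion at 0
    is a first-order expansion of [w]. *)
Lemma removable_singularity w r : 0 < r -> {for 0, continuous w} ->
  (forall t, t != 0 -> normc t < r -> differentiable w t) -> differentiable w 0.
Proof.
move=> r0 cw hw; pose G t := t * w t.
have smallw e : 0 < e -> exists2 d : R, 0 < d &
    forall t, normc t < d -> normc (w t - w 0) < e.
  move=> e0; have : nbhs (w 0) [set t | normc (t - w 0) < e].
    by apply/nbhsC; exists e.
  by move=> /cw /nbhsC[d d0 hd]; exists d => // t td; apply: hd; rewrite subr0.
(* At 0 the derivative of t * w t is w 0, by continuity alone. *)
have hG : \forall t \near (0 : C), differentiable G t.
  apply/nbhsC; exists r; first exact: r0.
  move=> t; rewrite subr0 => tr.
  have [->|t0] := eqVneq t 0; last first.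
    apply: differentiable_mul; last exact: hw.
    by apply/derivable1_diffP; exact: derivable_id.
  apply/differentiableCP; exists (w 0) => e e0.
  have [d d0 hd] := smallw e e0; exists d => // s sd.
  rewrite /G add0r mul0r subr0 [w 0 * _]mulrC -mulrBr normcM mulrC.
  by apply: ler_wpM2r; [exact: normc_ge0|apply: ltW; exact: hd].
have [p [q [K [e [K0 e0 hpq]]]]] := taylor2_at hG.
have exp t : t != 0 -> normc t <= e ->
    normc (w t - (p + q * t)) <= K * normc t ^+ 2.
  move=> t0 te; have := hpq t te; rewrite /G !add0r mul0r add0r.
  have -> : t * w t - (p * t + q * t ^+ 2) = t * (w t - (p + q * t)) by ring.
  rewrite normcM [K * _]mulrC exprS -mulrA ler_pM2l ?normc_gt0 //.
  by rewrite mulrC.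
(* Both sides are limits of w at 0; s is small enough for every error term. *)
have pw : p = w 0.
  apply/eqP; rewrite -subr_eq0 -normc_eq0; apply: contrapT => /negP n0.
  have N0 : 0 < normc (p - w 0) by rewrite lt_def n0 normc_ge0.
  set N := normc _ in N0.
  have N2 : 0 < N / 2 by lra.
  have [d d0 hd] := smallw _ N2.
  have L0 : 0 < normc q + K + 1 by have := normc_ge0 q; lra.
  pose s := Num.min (Num.min 1 (d / 2)) (Num.min e (N / 4 / (normc q + K + 1))).
  have s0 : 0 < s by rewrite /s !lt_min ltr01 e0 !divr_gt0 //; lra.
  have s1 : s <= 1 by rewrite /s !ge_min lexx.
  have s2 : s <= d / 2 by rewrite /s !ge_min lexx !orbT.
  have s3 : s <= e by rewrite /s !ge_min lexx !orbT.
  have s4 : s <= N / 4 / (normc q + K + 1) by rewrite /s !ge_min lexx !orbT.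
  have ns : normc s%:C = s by rewrite normc_real gtr0_norm.
  have sn0 : s%:C != 0 :> C by rewrite -normc_gt0 ns.
  have sne : normc s%:C <= e by rewrite ns.
  have := exp _ sn0 sne; rewrite ns => h1.
  have h2 : normc (w s%:C - w 0) < N / 2 by apply: hd; rewrite ns; lra.
  have : N <= normc (w s%:C - w 0) + (normc (w s%:C - (p + q * s%:C)) + normc (q * s%:C)).
    rewrite /N (_ : p - w 0 = (w s%:C - w 0) -
      ((w s%:C - (p + q * s%:C)) + q * s%:C)); last ring.
    by apply: le_trans (normcB _ _) _; rewrite lerD2l normcD.
  rewrite normcM ns => h3.
  move: s4; rewrite ler_pdivlMr // => s4.
  have : K * s ^+ 2 <= K * s by rewrite ler_wpM2l // expr2 ler_piMl ?(ltW s0).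
  move: h1 h2 h3 s4; set a := normc _; set b := normc _; set c := normc q; nra.
apply/differentiableCP; exists q => eps eps0.
exists (Num.min e (eps / (K + 1))); first by rewrite lt_min e0 divr_gt0 //; lra.
move=> t; rewrite lt_min => /andP[/ltW te]; rewrite ltr_pdivlMr; last lra.
move=> tK; have [->|t0] := eqVneq t 0.
  by rewrite addr0 subrr mulr0 subr0 normc0 mulr0.
have := exp t t0 te; rewrite add0r -pw opprD addrA => /le_trans; apply.
rewrite expr2 mulrA ler_wpM2r ?normc_ge0 //; have := normc_ge0 t; nra.
Qed.

Lemma compact_disc r : compact [set z : C | normc z <= r].
Proof.
pose h (p : R * R) : C := p.1 +i* p.2.
have hc : continuous h.
  move=> p A /nbhsC[e e0 hA]; have e2 : 0 < e / 2 by lra.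
  apply: (@filterS _ (nbhs p) _ (ball p (e / 2))); last exact: nbhsx_ballx.
  move=> q [] /=; rewrite -!ball_normE /ball_ /= => q1 q2; apply: hA.
  apply: le_lt_trans (normc_le_ReIm _) _ => /=.
  by rewrite (splitr e) distrC [`|q.2 - _|]distrC ltrD.
have cK : compact (`[- r, r]%classic `*` `[- r, r]%classic : set (R * R)).
  by apply: compact_setX; exact: segment_compact.
have cI := continuous_compact (continuous_subspaceT hc) cK.
apply: (subclosed_compact _ cI).
  rewrite (_ : [set z : C | _] = @normc R @^-1` [set x | x <= r]) //.
  apply: preimage_closed; last exact: closed_le.
  by move=> z _; exact: continuous_normc.
move=> [x y] /= zr; exists (x, y) => //=; rewrite !in_itv /= -!ler_norml.
have := le_trans (Re_le_normc (x +i* y)) zr.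
by have := le_trans (Im_le_normc (x +i* y)) zr => /= -> ->.
Qed.

(** At an interior maximum of Re u + e |z|^2 the second-order expansion of
    [u], summed over the four directions 1, i, -1, -i, only leaves the term
    in [e]. *)
Lemma max_principle u :
  (forall z, normc z <= 1 -> differentiable u z) ->
  (forall z, normc z = 1 -> complex.Re (u z) <= 0) ->
  forall z, normc z <= 1 -> complex.Re (u z) <= 0.
Proof.
move=> du bu z1 z11; rewrite leNgt; apply/negP => pos.
pose e := complex.Re (u z1) / 2; have e0 : 0 < e by rewrite /e; lra.
(* The weight e is half the offending value, so that the maximum of psi
   cannot be on the circle. *)
pose psi z := complex.Re (u z) + e * normc z ^+ 2.
have cpsi : {within [set z : C | normc z <= 1], continuous psi}.
  apply: continuous_in_subspaceT => z /set_mem /= zn.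
  apply: (@continuousD R R C (fun z => complex.Re (u z))).
    apply: (@continuous_comp _ _ _ u (@complex.Re R) z); last exact: continuous_Re.
    by apply: differentiable_continuous; exact: du.
  apply: (@continuousM R C (fun=> e)); first exact: cst_continuous.
  apply: (@continuous_comp _ _ _ (@normc R) (fun x : R => x ^+ 2) z).
    exact: continuous_normc.
  exact: exprn_continuous.
have [|z0 /set_mem /= z01 hmax] := compact_EVT_max _ (@compact_disc 1) cpsi.
  by exists 0; rewrite /= normc0.
have {}hmax z : normc z <= 1 -> psi z <= psi z0.
  by move=> zn; apply: hmax; rewrite inE.
have z0lt : normc z0 < 1.
  rewrite lt_neqAle z01 andbT; apply/eqP => E.
  have := hmax z1 z11; have := bu _ E.
  rewrite /psi E expr1n mulr1.
  have : 0 <= e * normc z1 ^+ 2 by rewrite mulr_ge0 ?exprn_ge0 ?normc_ge0 // ltW.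
  have : complex.Re (u z1) = 2 * e by rewrite /e; field.
  lra.
have hu : \forall t \near z0, differentiable u t.
  apply/nbhsC; exists (1 - normc z0); first lra.
  move=> t tz; apply: du; have := normcD (t - z0) z0; rewrite subrK; lra.
have [p [q [K [d [K0 d0 hd]]]]] := taylor2_at hu.
pose s := Num.min (Num.min d ((1 - normc z0) / 2)) (e / 2 / (K + 1)).
have K1 : 0 < K + 1 by lra.
have s0 : 0 < s by rewrite /s !lt_min d0 !divr_gt0 //; lra.
have s1 : s <= d by rewrite /s !ge_min lexx.
have s2 : s <= (1 - normc z0) / 2 by rewrite /s !ge_min lexx !orbT.
have s3 : s <= e / 2 / (K + 1) by rewrite /s !ge_min lexx !orbT.
have key t : normc t = s ->
    complex.Re (u z0 + p * t + q * t ^+ 2) + e * normc (z0 + t) ^+ 2 <=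
    psi z0 + K * s ^+ 3.
  move=> ts; have := hd t; rewrite ts => /(_ s1) h.
  have : psi (z0 + t) <= psi z0.
    by apply: hmax; apply: le_trans (normcD _ _) _; rewrite ts; lra.
  rewrite /psi => h2.
  have := le_trans (Re_le_normc _) h; rewrite ler_norml => /andP[h3 _].
  have E : forall a b : C, complex.Re (a - b) = complex.Re a - complex.Re b.
    by move=> [? ?] [? ?].
  move: h3; rewrite E; lra.
have n1 : normc (s%:C) = s by rewrite normc_real gtr0_norm.
(* The sum of these four inequalities is contradictory. *)
have k1 := key s%:C n1.
have k2 := key (- s%:C) (etrans (normcN _) n1).
have n3 : normc ('i * s%:C) = s by rewrite normcM normc_i mul1r.
have k3 := key ('i * s%:C) n3.
have k4 := key (- ('i * s%:C)) (etrans (normcN _) n3).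
move: k1 k2 k3 k4; rewrite /psi !sqr_normc.
move: s3; rewrite ler_pdivlMr // => s3.
have s20 : 0 < s ^+ 2 by rewrite exprn_gt0.
have : s ^+ 2 * (s * (K + 1)) <= s ^+ 2 * (e / 2) by rewrite ler_wpM2l // ltW.
case: (z0) => a b; case: (u _) => u1 u2; case: p {hd key} => p1 p2; case: q => q1 q2 /=.
rewrite !expr2 /= => *; nra.
Qed.

End Consequences.

(** * Holomorphic maps of several variables *)

Section RowVectors.
Local Open Scope complex_scope.
Variables (R : realType) (n : nat).
Local Notation C := R[i].
Local Notation V := 'rV[C]_n.
Implicit Types (u v w : V) (A : set V).

Lemma nbhsV v A : nbhs v A <-> exists2 e : R, 0 < e &
  forall w, (forall i, normc (w ord0 i - v ord0 i) < e) -> A w.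
Proof.
split.
- move/nbhs_ballP => [e /= /gt0C[-> e0] h]; exists (complex.Re e) => // w we.
  apply: h; split; first by rewrite ltcR.
  move=> i j; rewrite ord1 -ball_normE /ball_ /= distrC norm_normc ltcR.
  exact: we.
- move=> [e e0 h]; apply/nbhs_ballP; exists (e%:C)%C => /=; first by rewrite ltcR.
  move=> w [_ hw]; apply: h => i; have := hw ord0 i.
  by rewrite -ball_normE /ball_ /= distrC norm_normc ltcR.
Qed.

Lemma continuous_rV (T : topologicalType) (f : T -> V) x :
  (forall i, {for x, continuous (fun y => f y ord0 i : C)}) ->
  {for x, continuous f}.
Proof.
move=> h B /nbhsV[e e0 hB].
have : \forall y \near x, forall i, normc (f y ord0 i - f x ord0 i) < e.
  apply: filter_forall => i.
  have : nbhs (f x ord0 i) [set t : C | normc (t - f x ord0 i) < e].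
    by apply/nbhsC; exists e.
  exact: (h i).
by apply: filterS => y; exact: hB.
Qed.

Lemma continuous_coordV i v : {for v, continuous (fun w : V => w ord0 i : C)}.
Proof. exact: (@coord_continuous C 1 n ord0 i v). Qed.

Lemma differentiable_coordV (f : C -> V) i z : differentiable f z ->
  differentiable (fun t => f t ord0 i : C) z.
Proof.
move=> h.
exact: (@differentiable_comp _ _ _ _ f (fun M : V => M ord0 i) z h
  (differentiable_coord _ _ _)).
Qed.

Lemma differentiable_rV (f : C -> V) z :
  (forall i, differentiable (fun t => f t ord0 i : C) z) -> differentiable f z.
Proof.
move=> h.
have -> : f = \sum_(i < n) (fun z => (f z ord0 i) *: (delta_mx 0 i : V)).
  by apply/funext => t; rewrite fct_sumE [LHS]row_sum_delta.
by apply: differentiable_sum => i; apply: differentiableZl.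
Qed.

Lemma complex_onem (r : R) : (1 - r)%:C = 1 - r%:C :> C.
Proof. by rewrite rmorphB. Qed.

Lemma normc_quot (a p t : C) : t != 0 ->
  normc (t^-1 * a - p) * normc t = normc (a - p * t).
Proof. by move=> t0; rewrite -normcM; congr normc; field. Qed.

Lemma normc_triangle (a b c : C) : normc (a - b) <= normc (c - b) + normc (c - a).
Proof.
rewrite (_ : a - b = (c - b) - (c - a)); last by ring.
exact: normcB.
Qed.

Lemma convex_setP A : convex_set A <->
  forall v w (r : R), 0 <= r <= 1 -> A v -> A w ->
    A (r%:C *: v + (1 - r)%:C *: w).
Proof.
split=> [h v w r /andP[r0 r1] vA wA|h v w t].
  have r0' : 0 <= r%:C :> C by rewrite lecR.
  have r1' : r%:C <= 1 :> C by rewrite lecR.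
  have := h v w (Itv01 r0' r1'); rewrite !inE => /(_ vA wA).
  by rewrite complex_onem.
rewrite !inE => vA wA.
have t0 : 0 <= t%:inum :> C by [].
have t1 : t%:inum <= 1 :> C by [].
have tE : (complex.Re t%:inum)%:C = t%:inum :> C.
  by move: t0; case: (t%:inum) => a b; rewrite lecE /= => /andP[/eqP -> _].
have : A ((complex.Re t%:inum)%:C *: v + (1 - complex.Re t%:inum)%:C *: w).
  apply: h => //; rewrite -ler0c tE t0 /=.
  by move: t1; rewrite -tE lecR.
by rewrite complex_onem tE.
Qed.

(** Restricting to a complex line turns the differential into a limit in one
    variable. *)
Lemma derive_along (f : V -> V) v0 v j : differentiable f v0 ->
  forall e : R, 0 < e -> exists2 d : R, 0 < d & forall t, t != 0 -> normc t < d ->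
    normc (t^-1 * (f (v0 + t *: v) ord0 j - f v0 ord0 j) - ('d f v0 v) ord0 j) < e.
Proof.
move=> df e e0.
have dv := @diff_derivable _ _ _ f v0 v df.
have : h^-1 *: (f (h *: v + v0) - f v0) @[h --> (0 : C)^'] --> 'd f v0 v.
  by rewrite -deriveE //; exact: dv.
set l := 'd f v0 v => hl.
have nl : nbhs (l : V) [set w : V | normc (w ord0 j - l ord0 j) < e].
  by apply: (nbhsV _ _).2; exists e => // w; exact.
have hn := hl _ nl.
have {hn} : nbhs (0 : C) [set h : C | h != 0 ->
    normc ((h^-1 *: (f (h *: v + v0) - f v0)) ord0 j - l ord0 j) < e] := hn.
move=> /nbhsC[d d0 hd].
exists d => // t t0 td; have := hd t; rewrite subr0 => /(_ td t0) /=.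
by rewrite !mxE [t *: v + v0]addrC.
Qed.

Lemma normc_sum (I : finType) (F : I -> C) :
  normc (\sum_i F i) <= \sum_i normc (F i).
Proof.
elim/big_rec2 : _ => [|i x y _ h]; first by rewrite normc0.
by apply: le_trans (normcD _ _) _; rewrite lerD2l.
Qed.

Lemma term_le_sum (I : finType) (F : I -> R) i : (forall i, 0 <= F i) ->
  F i <= \sum_i F i.
Proof. by move=> F0; rewrite (bigD1 i) //= lerDl sumr_ge0. Qed.

Lemma linear_bound (A : {linear V -> V}) : exists2 K : R, 0 <= K &
  forall v r, 0 <= r -> (forall i, normc (v ord0 i) <= r) ->
    forall j, normc (A v ord0 j) <= K * r.
Proof.
pose K := \sum_i \sum_j normc (A (delta_mx 0 i) ord0 j).
have K0 : 0 <= K by apply: sumr_ge0 => i _; apply: sumr_ge0 => j _; exact: normc_ge0.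
exists K => // v r r0 vr j.
have -> : A v ord0 j = \sum_i v ord0 i * A (delta_mx 0 i) ord0 j.
  rewrite {1}[v]row_sum_delta linear_sum summxE; apply: eq_bigr => i _.
  by rewrite linearZ mxE.
apply: le_trans (normc_sum _) _; rewrite /K mulr_suml; apply: ler_sum => i _.
rewrite normcM mulrC; apply: ler_pM; rewrite ?normc_ge0 //.
apply: (@term_le_sum _ (fun j => normc (A (delta_mx 0 i) ord0 j))) => k.
exact: normc_ge0.
Qed.

(** The one-variable estimate on each complex line through [v0]; the linear
    coefficient found there is the value of the differential. *)
Lemma taylor1_rV (f : V -> V) v0 : (\forall v \near v0, differentiable f v) ->
  exists K e : R, [/\ 0 <= K, 0 < e & forall v r, 0 <= r <= e ->
    (forall i, normc (v ord0 i) <= r) -> forall j,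
    normc (f (v0 + v) ord0 j - (f v0 ord0 j + ('d f v0 v) ord0 j)) <= K * r ^+ 2].
Proof.
move=> hf; have df0 := nbhs_singleton hf.
move/nbhsV : hf => [r1 r10 hr1].
have n1 : nbhs (f v0) [set w : V | forall j, normc (w ord0 j - f v0 ord0 j) < 1].
  by apply: (nbhsV _ _).2; exists 1 => // w; exact.
have /nbhsV[r2 r20 hr2] := differentiable_continuous df0 n1.
pose s := Num.min (r1 / 2) (r2 / 2).
have s0 : 0 < s by rewrite /s lt_min !divr_gt0.
have s1 : s < r1 by apply: (@le_lt_trans _ _ (r1 / 2)); [rewrite /s ge_min lexx|lra].
have s2 : s < r2.
  by apply: (@le_lt_trans _ _ (r2 / 2)); [rewrite /s ge_min lexx orbT|lra].
pose M := 1 + \sum_j normc (f v0 ord0 j).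
have M0 : 0 <= M.
  by apply: addr_ge0 => //; apply: sumr_ge0 => j _; exact: normc_ge0.
exists (32 * M / s ^+ 2), (s / 4); split.
- by apply: divr_ge0; [apply: mulr_ge0|apply: exprn_ge0; apply: ltW].
- by rewrite divr_gt0.
move=> v r /andP[]; rewrite le_eqVlt => /predU1P[<- _ vr j|r0 rs vr j].
  have -> : v = 0.
    apply/rowP => i; rewrite mxE; apply/eqP; rewrite -normc_eq0.
    by rewrite eq_le normc_ge0 vr.
  by rewrite addr0 linear0 mxE addr0 subrr normc0 expr0n mulr0.
pose v' : V := (s / r)%:C *: v.
have v's i : normc (v' ord0 i) <= s.
  rewrite mxE normcM normc_real gtr0_norm ?divr_gt0 // mulrAC ler_pdivrMr //.
  by rewrite ler_pM2l.
pose G (t : C) := f (v0 + t *: v') ord0 j.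
have tv t i : normc t <= 1 -> normc ((v0 + t *: v') ord0 i - v0 ord0 i) <= s.
  move=> t1; rewrite !mxE addrC addKr normcM -[leRHS]mul1r.
  by apply: ler_pM; rewrite ?normc_ge0 //; have := v's i; rewrite mxE.
have dG t : normc t <= 1 -> differentiable G t.
  move=> t1; apply: (@differentiable_coordV (fun t => f (v0 + t *: v')) j).
  apply: (@differentiable_comp _ _ _ _ (fun t : C => v0 + t *: v') f).
    apply: (@differentiableD _ _ _ (fun=> v0)); first exact: differentiable_cst.
    apply: differentiableZl; apply/derivable1_diffP; exact: derivable_id.
  by apply: hr1 => i; apply: le_lt_trans (tv t i t1) _.
have GM t : normc t <= 1 -> normc (G t) <= M.
  move=> t1; have h : normc (G t - f v0 ord0 j) < 1.
    by apply: hr2 => i; apply: le_lt_trans (tv t i t1) _.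
  rewrite -(subrK (f v0 ord0 j) (G t)); apply: le_trans (normcD _ _) _.
  apply: lerD; first exact: ltW.
  by apply: (@term_le_sum _ (fun j => normc (f v0 ord0 j))) => k; exact: normc_ge0.
have [p hp] := taylor1_disc ltr01 dG GM.
have G0 : G 0 = f v0 ord0 j by rewrite /G scale0r addr0.
(* Uniqueness of the derivative along the line directed by v'. *)
have pE : p = ('d f v0 v') ord0 j.
  apply/eqP; rewrite -subr_eq0 -normc_eq0; apply: contrapT => /negP N0.
  have {N0} : 0 < normc (p - ('d f v0 v') ord0 j) by rewrite lt_def N0 normc_ge0.
  set l := ('d f v0 v') ord0 j; set N := normc _ => N0.
  have N2 : 0 < N / 2 by lra.
  have [d d0 hd] := derive_along v' j df0 N2.
  have M32 : 0 < 32 * M + 1 by lra.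
  pose t := Num.min (d / 2) (Num.min (1 / 4) (N / 4 / (32 * M + 1))).
  have t0 : 0 < t by rewrite /t !lt_min !divr_gt0 //; lra.
  have t1 : t <= d / 2 by rewrite /t !ge_min lexx.
  have t2 : t <= 1 / 4 by rewrite /t !ge_min lexx !orbT.
  have t3 : t <= N / 4 / (32 * M + 1) by rewrite /t !ge_min lexx !orbT.
  have nt : normc t%:C = t by rewrite normc_real gtr0_norm.
  have tn0 : t%:C != 0 :> C by rewrite -normc_gt0 nt.
  have td : normc t%:C < d by rewrite nt; lra.
  have := hd _ tn0 td; rewrite -/l -G0 -/(G t%:C) => h1.
  have t4 : normc t%:C <= 1 / 4 by rewrite nt.
  have := hp _ t4; rewrite expr1n divr1 nt => h2.
  have h3 : normc ((t%:C)^-1 * (G t%:C - G 0) - p) <= 32 * M * t.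
    have := normc_quot (G t%:C - G 0) p tn0; rewrite nt -addrA -opprD => Eq.
    by rewrite -(ler_pM2r t0) Eq; move: h2; rewrite expr2 mulrA.
  have : N <= normc ((t%:C)^-1 * (G t%:C - G 0) - l) +
              normc ((t%:C)^-1 * (G t%:C - G 0) - p).
    exact: normc_triangle.
  move: t3; rewrite ler_pdivlMr // => t3 h4.
  have : t * (32 * M + 1) = 32 * M * t + t by ring.
  lra.
pose z := (r / s)%:C : C.
have nz : normc z = r / s by rewrite normc_real gtr0_norm ?divr_gt0.
have zv : z *: v' = v.
  rewrite /v' scalerA -rmorphM /= (_ : r / s * (s / r) = 1) ?scale1r //.
  by field; rewrite !gt_eqF.
have z4 : normc z <= 1 / 4 by rewrite nz ler_pdivrMr //; lra.
have := hp z z4; rewrite pE nz G0 /G zv.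
have -> : 'd f v0 v' ord0 j * z = 'd f v0 v ord0 j.
  by rewrite -[in RHS]zv [in RHS]linearZ [in RHS]mxE mulrC.
move=> h; apply: (le_trans h); rewrite le_eqVlt; apply/orP; left; apply/eqP.
by field; rewrite gt_eqF.
Qed.

Lemma diff_left_inverse (f g : V -> V) v0 : differentiable f v0 ->
  differentiable g (f v0) -> (\forall v \near v0, g (f v) = v) ->
  forall v, 'd g (f v0) ('d f v0 v) = v.
Proof.
move=> df dg gf v.
have dgf := differentiable_comp df dg.
have E : 'd (g \o f) v0 v = v.
  rewrite -deriveE //.
  have -> : 'D_v (g \o f) v0 = 'D_v id v0.
    by apply: near_eq_derive; exact: gf.
  exact: derive_id.
have H := @diff_comp _ _ _ _ f g v0 df dg.
have H' := congr1 (fun h : V -> V => h v) H.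
exact: (etrans (esym H') E).
Qed.

(** The linear terms of [f] and [g] cancel because their differentials are
    inverse to each other, and the quadratic remainders are controlled by
    [taylor1_rV]. *)
Lemma convex_comb_expansion (f g : V -> V) v0 (a b : C) :
  normc a <= 1 -> normc b <= 1 -> a + b = 1 ->
  (\forall v \near v0, differentiable f v) ->
  (\forall v \near f v0, differentiable g v) ->
  (\forall v \near v0, g (f v) = v) ->
  exists K e : R, [/\ 0 <= K, 0 < e & forall v w r, 0 <= r <= e ->
    (forall i, normc (v ord0 i) <= r) -> (forall i, normc (w ord0 i) <= r) ->
    forall j, normc ((g (a *: f (v0 + v) + b *: f (v0 + w))) ord0 j -
                     (v0 + (a *: v + b *: w)) ord0 j) <= K * r ^+ 2].
Proof.
move=> a1 b1 ab df dg gf.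
have [K1 [e1 [K10 e10 h1]]] := taylor1_rV df.
have [K2 [e2 [K20 e20 h2]]] := taylor1_rV dg.
have df0 := nbhs_singleton df; have dg0 := nbhs_singleton dg.
have dl := diff_left_inverse df0 dg0 gf.
have gf0 : g (f v0) = v0 := nbhs_singleton gf.
have [A A0 hA] := linear_bound ('d f v0).
have [B B0 hB] := linear_bound ('d g (f v0)).
pose L := 2 * A + 2 * K1; have L0 : 0 <= L by rewrite /L; lra.
have L1 : 0 < L + 1 by lra.
pose e := Num.min (Num.min 1 e1) (e2 / (L + 1)).
have ee0 : 0 < e by rewrite /e !lt_min ltr01 e10 divr_gt0.
exists (K2 * L ^+ 2 + B * (2 * K1)), e; split=> //.
  by rewrite addr_ge0 // mulr_ge0 ?exprn_ge0 // mulr_ge0.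
move=> v w r /andP[r0 re] vr wr j.
have r1 : r <= 1 by apply: (le_trans re); rewrite /e !ge_min lexx.
have re1 : 0 <= r <= e1 by rewrite r0 (le_trans re) // /e !ge_min lexx !orbT.
have re2 : r * (L + 1) <= e2.
  by rewrite -ler_pdivlMr // (le_trans re) // /e !ge_min lexx !orbT.
pose E (x : V) : V := f (v0 + x) - (f v0 + 'd f v0 x).
have hE (x : V) : (forall i, normc (x ord0 i) <= r) ->
    forall i, normc (E x ord0 i) <= K1 * r ^+ 2.
  by move=> xr i; have := h1 x r re1 xr i; rewrite /E !mxE.
pose x := a *: v + b *: w; pose Ex := a *: E v + b *: E w.
have comb (p q : V) (s : R) : (forall i, normc (p ord0 i) <= s) ->
    (forall i, normc (q ord0 i) <= s) ->
    forall i, normc ((a *: p + b *: q) ord0 i) <= 2 * s.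
  move=> hp hq i; rewrite !mxE; apply: le_trans (normcD _ _) _.
  rewrite mulr_natl mulr2n; apply: lerD; rewrite normcM -[leRHS]mul1r;
  by apply: ler_pM; rewrite ?normc_ge0.
have qE : a *: f (v0 + v) + b *: f (v0 + w) = f v0 + ('d f v0 x + Ex).
  have -> : 'd f v0 x = a *: 'd f v0 v + b *: 'd f v0 w.
    by rewrite /x linearD !linearZ.
  have bE : b = 1 - a by rewrite -ab addrC addKr.
  by apply/rowP => i; rewrite /Ex /E !mxE bE; ring.
pose y := 'd f v0 x + Ex.
have yr i : normc (y ord0 i) <= L * r.
  rewrite mxE; apply: le_trans (normcD _ _) _.
  have xr := comb v w r vr wr.
  have r20 : 0 <= 2 * r by lra.
  have := hA x (2 * r) r20 xr i.
  have := comb (E v) (E w) _ (hE v vr) (hE w wr) i; rewrite -/Ex.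
  have : r ^+ 2 <= r by rewrite expr2 ler_piMr.
  have := ler_wpM2l K10 (_ : r ^+ 2 <= r); rewrite /L.
  move=> H h; move: (H h); lra.
have Lre : 0 <= L * r <= e2.
  rewrite mulr_ge0 //=; apply: le_trans re2; rewrite mulrDr mulr1 mulrC; lra.
have := h2 y (L * r) Lre yr j; rewrite qE -/y gf0.
have -> : 'd g (f v0) y = x + 'd g (f v0) Ex by rewrite /y linearD dl.
have r22 : 0 <= 2 * (K1 * r ^+ 2) by rewrite !mulr_ge0 ?exprn_ge0.
have := hB Ex (2 * (K1 * r ^+ 2)) r22 (comb (E v) (E w) _ (hE v vr) (hE w wr)) j.
set P := g _ ord0 j; set Q := 'd g _ Ex ord0 j; rewrite -/x.
have -> : (x + 'd g (f v0) Ex) ord0 j = x ord0 j + Q by rewrite mxE.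
have -> : (v0 + x) ord0 j = v0 ord0 j + x ord0 j by rewrite mxE.
move=> hQ hP.
have -> : P - (v0 ord0 j + x ord0 j) = (P - (v0 ord0 j + (x ord0 j + Q))) + Q by ring.
apply: le_trans (normcD _ _) _; rewrite mulrDl; apply: lerD.
  by apply: (le_trans hP); rewrite exprMn mulrA.
by apply: (le_trans hQ); rewrite !mulrA.
Qed.

End RowVectors.

(** * Compact convex sets and holomorphic discs *)

Section Convexity.
Local Open Scope complex_scope.
Variables (R : realType) (n : nat).
Local Notation C := R[i].
Local Notation V := 'rV[C]_n.
Implicit Types (v w l : V) (A G K L : set V).

(** The square of the Euclidean distance, not of the distance in the sup norm:
    the nearest point argument needs an inner product. *)
Definition sqdist (l v : V) : R := \sum_i normc (v ord0 i - l ord0 i) ^+ 2.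

Lemma sqdist_ge0 l v : 0 <= sqdist l v.
Proof. by apply: sumr_ge0 => i _; rewrite exprn_ge0 ?normc_ge0. Qed.

Lemma sqdist_coord l v i : normc (v ord0 i - l ord0 i) ^+ 2 <= sqdist l v.
Proof.
apply: (@term_le_sum R _ (fun i => normc (v ord0 i - l ord0 i) ^+ 2)) => j.
by rewrite exprn_ge0 ?normc_ge0.
Qed.

Lemma continuous_sum_at (T : topologicalType) (I : finType) (F : I -> T -> R) x :
  (forall i, {for x, continuous (F i)}) ->
  {for x, continuous (fun y => \sum_i F i y)}.
Proof.
move=> hF.
have -> : (fun y => \sum_i F i y) = \sum_i F i.
  by apply/funext => y; rewrite fct_sumE.
elim/big_ind : _ => [|g h hg hh|i _]; last exact: hF.
  exact: cst_continuous.
exact: (@continuousD R R T g h x hg hh).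
Qed.

Lemma continuous_sqdist l v : {for v, continuous (sqdist l)}.
Proof.
apply: (@continuous_sum_at V 'I_n (fun i w => normc (w ord0 i - l ord0 i) ^+ 2)) => i.
apply: (@continuous_comp V C R (fun w => w ord0 i - l ord0 i) (fun z => normc z ^+ 2)).
  apply: (@continuousD C C V (fun w => w ord0 i) (fun=> - l ord0 i)).
    exact: continuous_coordV.
  exact: cst_continuous.
apply: (@continuous_comp _ _ _ (@normc R) (fun x : R => x ^+ 2)).
  exact: continuous_normc.
exact: exprn_continuous.
Qed.

Lemma compact_coord_bounded K : compact K -> exists M : R, forall v i, K v ->
  normc (v ord0 i) <= M.
Proof.
move=> cK; have [K0|/nonemptyPn K0] := pselect (K !=set0); last first.
  by exists 0 => v i; rewrite K0.
have cs : {within K, continuous (sqdist 0)}.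
  by apply: continuous_in_subspaceT => v _; exact: continuous_sqdist.
have [w _ hw] := compact_EVT_max K0 cK cs.
exists (1 + sqdist 0 w) => v i vK.
have := hw v; rewrite inE => /(_ vK).
have := sqdist_coord 0 v i; rewrite mxE subr0 expr2.
have := sqdist_ge0 0 w; have := normc_ge0 (v ord0 i); nra.
Qed.

Lemma sqr_normcB (a b : C) (s : R) : normc (a - s%:C * b) ^+ 2 =
  normc a ^+ 2 - 2 * s * complex.Re (b * a^*) + s ^+ 2 * normc b ^+ 2.
Proof. by rewrite !sqr_normc; case: a => a1 a2; case: b => b1 b2 /=; ring. Qed.

Lemma Re_sum (I : finType) (F : I -> C) :
  complex.Re (\sum_i F i) = \sum_i complex.Re (F i).
Proof.
elim/big_rec2 : _ => // i x y _ <-.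
by case: (F i) => ? ?; case: y => ? ?.
Qed.

Lemma differentiable_sumC (I : finType) (F : I -> C -> C) z :
  (forall i, differentiable (F i) z) -> differentiable (fun t => \sum_i F i t) z.
Proof.
move=> hF; have -> : (fun y => \sum_i F i y) = \sum_i F i.
  by apply/funext => y; rewrite fct_sumE.
elim/big_ind : _ => [|g h hg hh|i _]; last exact: hF.
  exact: differentiable_cst.
exact: differentiableD.
Qed.

(** Otherwise the nearest point of [L] to an offending value gives a real
    linear functional whose maximum over the disc is not on the circle. *)
Lemma max_principle_convex (u : C -> V) L : compact L -> convex_set L ->
  (forall z, normc z <= 1 -> differentiable u z) ->
  (forall z, normc z = 1 -> L (u z)) ->
  forall z, normc z <= 1 -> L (u z).
Proof.
move=> cL /convex_setP vL du bu z1 z11; apply: contrapT => nL.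
have L0 : L !=set0 by exists (u 1); apply: bu; rewrite normc1.
have cs : {within L, continuous (sqdist (u z1))}.
  by apply: continuous_in_subspaceT => v _; exact: continuous_sqdist.
have [l0 /set_mem l0L hl] := compact_EVT_min L0 cL cs.
pose d i := u z1 ord0 i - l0 ord0 i.
pose ip (v : V) : C := \sum_i (v ord0 i - l0 ord0 i) * (d i)^*.
(* Moving from l0 towards v by a small s does not decrease the distance to u z1. *)
have side v : L v -> complex.Re (ip v) <= 0.
  move=> vv; rewrite leNgt; apply/negP => pos.
  pose E := \sum_i normc (v ord0 i - l0 ord0 i) ^+ 2.
  have E0 : 0 <= E by apply: sumr_ge0 => i _; rewrite exprn_ge0 ?normc_ge0.
  pose s := Num.min 1 (complex.Re (ip v) / (E + 1)).
  have E1 : 0 < E + 1 by lra.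
  have s0 : 0 < s by rewrite /s lt_min ltr01 divr_gt0.
  have s1 : s <= 1 by rewrite /s ge_min lexx.
  have s2 : s <= complex.Re (ip v) / (E + 1) by rewrite /s ge_min lexx orbT.
  have sL : L (s%:C *: v + (1 - s)%:C *: l0) by apply: vL => //; rewrite (ltW s0).
  have := hl _ (mem_set sL).
  have -> : sqdist (u z1) (s%:C *: v + (1 - s)%:C *: l0) =
      sqdist (u z1) l0 - 2 * s * complex.Re (ip v) + s ^+ 2 * E.
    rewrite /sqdist /ip /E Re_sum !mulr_sumr -sumrB -big_split /=.
    apply: eq_bigr => i _; rewrite !mxE -/(d i).
    rewrite [normc (l0 _ _ - _)]normc_distC -/(d i) -sqr_normcB normc_distC.
    congr (normc _ ^+ 2); rewrite /d complex_onem; ring.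
  move: s2; rewrite ler_pdivlMr //.
  have : s * (s * (E + 1)) = s ^+ 2 * E + s ^+ 2 by ring.
  move: pos E0; set I := complex.Re _; set S := sqdist _ _; nra.
have dpos : 0 < complex.Re (ip (u z1)).
  have -> : complex.Re (ip (u z1)) = sqdist l0 (u z1).
    rewrite /ip Re_sum; apply: eq_bigr => i _; rewrite -/(d i) sqr_normc.
    by case: (d i) => a b /=; ring.
  rewrite lt_def sqdist_ge0 andbT; apply/eqP => S0; apply: nL.
  suff -> : u z1 = l0 by [].
  apply/rowP => i; apply/eqP; rewrite -subr_eq0 -normc_eq0 -sqrf_eq0.
  by rewrite eq_le sqr_ge0 andbT -S0 sqdist_coord.
have := @max_principle R (fun z => ip (u z)) _ _ z1 z11.
rewrite leNgt dpos => /(_ _ _)/negP; apply=> //.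
- move=> z zn; apply: differentiable_sumC => i; apply: differentiable_mul; last first.
    exact: differentiable_cst.
  apply: (@differentiableB C C C (fun z => u z ord0 i)); last exact: differentiable_cst.
  by apply: differentiable_coordV; exact: du.
- by move=> z /bu; exact: side.
Qed.

Lemma homothety_comb (x0 v w : V) (a s : C) :
  x0 + s *: (a *: v + (1 - a) *: w - x0) =
  a *: (x0 + s *: (v - x0)) + (1 - a) *: (x0 + s *: (w - x0)).
Proof. by apply/rowP => i; rewrite !mxE; ring. Qed.

(** The image of [K] under a homothety of ratio slightly larger than 1 stays
    in [G]; shrinking [G] back by that ratio leaves room for the closure. *)
Lemma compact_in_convex G K x0 : open G -> convex_set G -> G x0 ->
  compact K -> K `<=` G ->
  exists L, [/\ compact L, convex_set L, K `<=` L & L `<=` G].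
Proof.
move=> oG /convex_setP vG Gx0 cK KG.
have [e e0 he] : exists2 e : R, 0 < e & forall s : C, normc (s - 1) < e ->
    forall w, K w -> G (x0 + s *: (w - x0)).
  have ncK := (compact_near_coveringP K).1 cK.
  have := ncK C (nbhs (1 : C)) (fun s w => G (x0 + s *: (w - x0))) _ _.
  move=> /(_ _ _)/nbhsC; apply => w Kw.
  pose Phi (p : V * C) : V := x0 + p.2 *: (p.1 - x0).
  have cPhi : {for (w, 1 : C), continuous Phi}.
    apply: continuous_rV => i.
    have -> : (fun p => Phi p ord0 i) =
        (fun p => x0 ord0 i + p.2 * (p.1 ord0 i - x0 ord0 i)).
      by apply/funext => p; rewrite /Phi !mxE.
    apply: (@continuousD C C _ (fun=> x0 ord0 i)); first exact: cst_continuous.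
    apply: (@continuousM C _ (fun p => p.2)); first exact: cvg_snd.
    apply: (@continuousD C C _ (fun p : V * C => p.1 ord0 i) (fun=> - x0 ord0 i)).
      apply: (@continuous_comp _ _ _ (fun p : V * C => p.1) (fun v : V => v ord0 i)).
        exact: cvg_fst.
      exact: continuous_coordV.
    exact: cst_continuous.
  have : nbhs (Phi (w, 1)) G.
    rewrite /Phi scale1r addrC subrK; apply: open_nbhs_nbhs; split=> //.
    exact: KG.
  exact: cPhi.
pose s : R := 1 + e / 2.
have s1 : 1 < s by rewrite /s; lra.
have s0 : 0 < s by lra.
pose U : set V := [set w | G (x0 + s%:C *: (w - x0))].
have KU : K `<=` U.
  move=> w Kw; apply: he => //.
  rewrite /s rmorphD /= addrC addKr normc_real gtr0_norm; lra.
have [M hM] := compact_coord_bounded cK.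
pose box : set V := [set v | forall i, [set z : C | normc z <= M] (v ord0 i)].
have cbox : compact box.
  by apply: (@rV_compact C n (fun=> [set z : C | normc z <= M])) => _; exact: compact_disc.
exists (box `&` closure U); split.
- exact: compact_closedI cbox (@closed_closure _ _).
- apply/convex_setP => v w r r01 [bv cv] [bw cw]; have /andP[r0 r1] := r01.
  have r2 : normc r%:C = r by rewrite normc_real ger0_norm.
  have r3 : normc (1 - r)%:C = 1 - r by rewrite normc_real ger0_norm //; lra.
  have comb (a b : C) (m : R) : normc a <= m -> normc b <= m ->
      normc (r%:C * a + (1 - r)%:C * b) <= m.
    move=> am bm; apply: le_trans (normcD _ _) _; rewrite !normcM r2 r3.
    have := normc_ge0 a; have := normc_ge0 b; nra.
  split; first by move=> i; rewrite !mxE; apply: comb; [exact: bv|exact: bw].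
  move=> B /nbhsV[d d0 hB].
  have nb (x : V) : nbhs x [set y : V | forall i, normc (y ord0 i - x ord0 i) < d / 2].
    by apply: (nbhsV _ _).2; exists (d / 2); [lra|move=> ?; exact].
  have [v' [Uv' dv']] := cv _ (nb v); have [w' [Uw' dw']] := cw _ (nb w).
  exists (r%:C *: v' + (1 - r)%:C *: w'); split.
    rewrite /U /=.
    have -> : x0 + s%:C *: (r%:C *: v' + (1 - r)%:C *: w' - x0) =
      r%:C *: (x0 + s%:C *: (v' - x0)) + (1 - r)%:C *: (x0 + s%:C *: (w' - x0)).
      by rewrite complex_onem homothety_comb.
    exact: vG.
  apply: hB => i; rewrite !mxE.
  have -> : r%:C * v' ord0 i + (1 - r)%:C * w' ord0 i -
      (r%:C * v ord0 i + (1 - r)%:C * w ord0 i) =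
      r%:C * (v' ord0 i - v ord0 i) + (1 - r)%:C * (w' ord0 i - w ord0 i) by ring.
  apply: (@le_lt_trans _ _ (d / 2)); last by lra.
  by apply: comb; apply: ltW; [exact: dv'|exact: dw'].
- by move=> w Kw; split; [move=> i; exact: hM|apply: subset_closure; exact: KU].
- move=> w [_ cw].
  have /nbhsV[d d0 hd] : nbhs x0 G by apply: open_nbhs_nbhs.
  have s2 : 0 < 1 - s^-1 by rewrite subr_gt0 invf_lt1.
  have nw : nbhs w [set y : V | forall i, normc (y ord0 i - w ord0 i) < d * (1 - s^-1)].
    by apply: (nbhsV _ _).2; exists (d * (1 - s^-1)); [exact: mulr_gt0|move=> ?; exact].
  have [w' [Uw' dw']] := cw _ nw.
  (* w is a convex combination of a point of G near its dilate and of a point y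
     near x0. *)
  pose y : V := x0 + (1 - s^-1)^-1%:C *: (w - w').
  have Gy : G y.
    apply: hd => i; rewrite /y !mxE addrAC subrr add0r normcM normc_real.
    rewrite gtr0_norm ?invr_gt0 // mulrC ltr_pdivrMr // normc_distC.
    exact: dw'.
  have si : 0 <= s^-1 <= 1 by rewrite invr_ge0 (ltW s0) /=; lra.
  have := vG _ _ s^-1 si Uw' Gy.
  suff -> : s^-1%:C *: (x0 + s%:C *: (w' - x0)) + (1 - s^-1)%:C *: y = w by [].
  rewrite /y !scalerDr !scalerA -!rmorphM /= mulVf ?gt_eqF // mulfV ?gt_eqF //.
  by apply/rowP => i; rewrite !mxE complex_onem; ring.
Qed.

End Convexity.

(** * Weighted dilations and analytic discs *)

Section Balanced.
Local Open Scope complex_scope.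
Variables (R : realType) (n : nat) (k : 'I_n -> nat).
Local Notation C := R[i].
Local Notation V := 'rV[C]_n.
Implicit Types (v w : V) (D G K L : set V).

Definition wscale (lam : C) v : V := \row_i (lam ^+ k i * v ord0 i).

Lemma wscaleM (a b : C) v : wscale a (wscale b v) = wscale (a * b) v.
Proof. by apply/rowP => i; rewrite !mxE exprMn mulrA. Qed.

Lemma wscale1 v : wscale 1 v = v.
Proof. by apply/rowP => i; rewrite mxE expr1n mul1r. Qed.

Lemma wscale0 v : (forall i, (0 < k i)%N) -> wscale 0 v = 0.
Proof. by move=> k0; apply/rowP => i; rewrite !mxE expr0n eqn0Ngt k0 mul0r. Qed.

Lemma continuous_wscale (T : topologicalType) (s : T -> C) (h : T -> V) x :
  {for x, continuous s} -> {for x, continuous h} ->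
  {for x, continuous (fun y => wscale (s y) (h y))}.
Proof.
move=> cs ch; apply: continuous_rV => i.
have -> : (fun y => wscale (s y) (h y) ord0 i) = (fun y => s y ^+ k i * h y ord0 i).
  by apply/funext => y; rewrite mxE.
apply: (@continuousM C T (fun y => s y ^+ k i)).
  apply: (@continuous_comp T C C s (fun z => z ^+ k i)); first exact: cs.
  by apply: differentiable_continuous; exact: differentiable_exp.
apply: (@continuous_comp T V C h (fun v => v ord0 i)); first exact: ch.
exact: continuous_coordV.
Qed.

Lemma differentiable_wscale (s : C -> C) (h : C -> V) z :
  differentiable s z -> differentiable h z ->
  differentiable (fun t => wscale (s t) (h t)) z.
Proof.
move=> ds dh; apply: differentiable_rV => i.
have -> : (fun t => wscale (s t) (h t) ord0 i) = (fun t => s t ^+ k i * h t ord0 i).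
  by apply/funext => t; rewrite mxE.
apply: differentiable_mul; last exact: differentiable_coordV.
apply: (@differentiable_comp _ _ _ _ s (fun z => z ^+ k i)); first exact: ds.
exact: differentiable_exp.
Qed.

Lemma continuous_realC : continuous (fun t : R => t%:C : C).
Proof.
move=> t A /nbhsC[e e0 hA]; apply: (@filterS _ (nbhs t) _ (ball t e)).
  move=> s; rewrite -ball_normE /ball_ /= distrC => se; apply: hA.
  by rewrite -rmorphB normc_real.
exact: nbhsx_ballx.
Qed.

Lemma compact_circle : compact [set z : C | normc z = 1].
Proof.
have -> : [set z : C | normc z = 1] = [set z : C | normc z <= 1] `&` [set z | normc z = 1].
  by apply/seteqP; split=> z /=; [move=> ->|case].
apply: compact_closedI; first exact: compact_disc.
rewrite (_ : [set z : C | _] = @normc R @^-1` [set 1]) //.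
apply: preimage_closed; last exact: closed_eq.
by move=> z _; exact: continuous_normc.
Qed.

(** The parameters s in [0, 1] for which the disc wscale s (h z) lies in a fixed
    domain biholomorphic to a convex one form an open and closed set: the
    maximum principle in the convex model confines these discs to a compact
    subset of that domain. *)
Lemma balanced_disc D (h : C -> V) : (forall i, (0 < k i)%N) ->
  weighted_balanced k D -> classE D ->
  (forall z, normc z <= 1 -> differentiable h z) ->
  (forall z, normc z = 1 -> D (h z)) -> D (h 0).
Proof.
move=> k0 balD [_ exD] dh bh.
pose Phi (p : C * C) : V := wscale p.1 (h p.2).
pose P : set (C * C) := [set z | normc z <= 1] `*` [set z | normc z = 1].
have cPhi : compact (Phi @` P).
  apply: continuous_compact; last first.
    by apply: compact_setX; [exact: compact_disc|exact: compact_circle].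
  apply: continuous_in_subspaceT => p /set_mem [/= p1 p2].
  apply: (@continuous_wscale _ fst (fun p => h p.2)); first exact: cvg_fst.
  apply: (@continuous_comp _ _ _ snd h); first exact: cvg_snd.
  by apply: differentiable_continuous; apply: dh; rewrite p2.
have PhiD : Phi @` P `<=` D.
  by move=> _ [p [/= p1 /bh p2] <-]; apply: balD; rewrite ?norm_normc ?lecR.
have [D' [domD' KD' D'D [G [[_ oG _] vG] [f [g [hf hg [fD gG] fgK _]]]]]] :=
  exD _ cPhi PhiD.
have [_ oD' _] := domD'.
pose K := f @` (Phi @` P).
have cK : compact K.
  apply: continuous_compact cPhi.
  apply: continuous_in_subspaceT => v /set_mem /KD' D'v.
  by apply: differentiable_continuous; exact: hf.
have KG : K `<=` G by move=> _ [v /KD' D'v <-]; apply: fD; exists v.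
have D'0 : D' 0.
  apply: KD'; exists (0, 1) => /=; last by rewrite /Phi /= wscale0.
  by split=> /=; rewrite ?normc0 ?normc1.
have Gf0 : G (f 0) by apply: fD; exists 0.
have [L [cL vL KL LG]] := compact_in_convex oG vG Gf0 cK KG.
pose N := g @` L.
have cN : compact N.
  apply: continuous_compact cL; apply: continuous_in_subspaceT => v /set_mem /LG Gv.
  by apply: differentiable_continuous; exact: hg.
have clN : closed N by apply: compact_closed cN; exact: norm_hausdorff.
have ND' : N `<=` D' by move=> _ [v /LG Gv <-]; apply: gG; exists v.
pose O : set R := [set s | forall z, normc z <= 1 -> D' (wscale s%:C (h z))].
pose O' : set R := [set s | forall z, normc z <= 1 -> N (wscale s%:C (h z))].
have O'O : O' `<=` O by move=> s hs z z1; apply: ND'; exact: hs.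
have OO' s : 0 <= s <= 1 -> O s -> O' s.
  move=> /andP[s0 s1] Os z z1.
  have dsh t : normc t <= 1 -> differentiable (fun z => wscale s%:C (h z)) t.
    move=> t1; apply: (@differentiable_wscale (fun=> s%:C)); last exact: dh.
    exact: differentiable_cst.
  have uL : L (f (wscale s%:C (h z))).
    apply: (@max_principle_convex R n (fun z => f (wscale s%:C (h z))) L cL vL _ _ z z1).
      move=> t t1; apply: (@differentiable_comp _ _ _ _ (fun z => wscale s%:C (h z)) f).
        exact: dsh.
      by apply: hf; exact: Os.
    move=> t t1; apply: KL; exists (wscale s%:C (h t)) => //.
    exists (s%:C, t) => //; split=> //=.
    by rewrite normc_real ger0_norm.
  exists (f (wscale s%:C (h z))) => //.
  by apply: fgK; rewrite inE; exact: Os.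
have oO : open O.
  rewrite openE => s Os.
  have nc := (compact_near_coveringP _).1 (@compact_disc R 1).
  apply: (nc R (nbhs s) (fun s z => D' (wscale s%:C (h z)))) => z z1.
  have : nbhs (wscale s%:C (h z)) D' by apply: open_nbhs_nbhs; split=> //; exact: Os.
  suff : {for (z, s), continuous (fun p : C * R => wscale p.2%:C (h p.1))} by exact.
  apply: (@continuous_wscale _ (fun p : C * R => p.2%:C) (fun p => h p.1)).
    apply: (@continuous_comp _ _ _ snd (fun t : R => t%:C : C)); first exact: cvg_snd.
    exact: continuous_realC.
  apply: (@continuous_comp _ _ _ fst h); first exact: cvg_fst.
  by apply: differentiable_continuous; exact: dh.
have clO' : closed O'.
  have -> : O' = \bigcap_(z in [set z : C | normc z <= 1])
      ((fun s : R => wscale s%:C (h z)) @^-1` N) by [].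
  apply: closed_bigI => z _; apply: preimage_closed clN => s _.
  apply: (@continuous_wscale _ (fun t : R => t%:C) (fun=> h z)).
    exact: continuous_realC.
  exact: cst_continuous.
have conn : `[0, 1]%classic `&` O = `[(0 : R), 1]%classic.
  apply: segment_connected.
  - exists 0; split; first by rewrite /= in_itv /= lexx ler01.
    by move=> z _; rewrite wscale0.
  - by exists O.
  - exists O' => //; apply/seteqP; split=> s [s01 hs]; split=> //.
      by apply: OO' => //; move: s01; rewrite /= in_itv.
    exact: O'O.
have [_ O1] : (`[0, 1]%classic `&` O) 1 by rewrite conn /= in_itv /= lexx ler01.
have n01 : normc (0 : C) <= 1 by rewrite normc0.
have := O1 0 n01; rewrite (_ : 1%:C = 1) // wscale1; exact: D'D.
Qed.

Lemma near_eq_differentiable (f g : C -> C) z : (\forall t \near z, f t = g t) ->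
  differentiable f z -> differentiable g z.
Proof.
move=> fg /differentiableCP[c hc]; apply/differentiableCP; exists c => e e0.
have fgz := nbhs_singleton fg; move/nbhsC : fg => [d1 d10 h1].
have [d2 d20 h2] := hc e e0; exists (Num.min d1 d2); first by rewrite lt_min d10.
move=> w; rewrite lt_min => /andP[w1 w2].
have zw : normc (z + w - z) < d1 by rewrite addrC addKr.
have E1 : f (z + w) = g (z + w) := h1 _ zw.
have E2 : f z = g z := fgz.
by rewrite -E1 -E2; exact: h2.
Qed.

Lemma normc_wscale_le (kap : nat) (lam : C) v (M : R) : normc lam <= 1 ->
  (forall i, normc (v ord0 i) <= M) ->
  (forall i, v ord0 i = 0 \/ (kap <= k i)%N) ->
  forall i, normc (wscale lam v ord0 i) <= M * normc lam ^+ kap.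
Proof.
move=> l1 vM hv i; rewrite mxE normcM normcX.
have M0 : 0 <= M := le_trans (normc_ge0 _) (vM i).
have [->|ki] := hv i.
  by rewrite normc0 mulr0 mulr_ge0 // exprn_ge0 // normc_ge0.
rewrite mulrC; apply: ler_pM; rewrite ?normc_ge0 ?exprn_ge0 ?normc_ge0 //.
by apply: ler_wiXn2l => //; exact: normc_ge0.
Qed.

End Balanced.

(** * Weighted combinations of points *)

Section Main.
Local Open Scope complex_scope.
Variables (R : realType) (n : nat) (k : 'I_n -> nat).
Local Notation C := R[i].
Local Notation V := 'rV[C]_n.
Implicit Types (v w : V) (D G K L : set V).

(** The disc phi / wscale has centre the convex combination and boundary in
    [D]; the condition on [kap] makes its singularity at 0 removable. *)
Lemma weighted_combination D (kap : nat) (a b : V) (r : R) :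
  (forall i, (0 < k i)%N) -> (forall i, (k i < 2 * kap)%N) ->
  weighted_balanced k D -> classE D -> 0 <= r <= 1 -> D a -> D b ->
  (forall i, a ord0 i = 0 \/ (kap <= k i)%N) ->
  (forall i, b ord0 i = 0 \/ (kap <= k i)%N) ->
  D (r%:C *: a + (1 - r)%:C *: b).
Proof.
move=> k0 kkap balD clD /andP[r0 r1] Da Db ha hb.
have [[_ oD _] exD] := clD.
(* Room for radii slightly larger than 1 makes the discs holomorphic on a
   neighbourhood of the closed unit disc. *)
have enlarge v : D v -> exists2 e : R, 0 < e &
    forall s : C, normc (s - 1) < e -> D (wscale k s v).
  move=> Dv; have nD : nbhs (wscale k 1 v) D.
    by rewrite wscale1; apply: open_nbhs_nbhs; split.
  have cw : {for (1 : C), continuous (fun s : C => wscale k s v)}.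
    apply: (@continuous_wscale _ _ k C id (fun=> v)); first exact: cvg_id.
    exact: cst_continuous.
  by have /nbhsC[e e0 he] := cw _ nD; exists e.
have [ea ea0 hea] := enlarge a Da; have [eb eb0 heb] := enlarge b Db.
pose c : R := 1 + Num.min ea eb / 2.
have m0 : 0 < Num.min ea eb by rewrite lt_min ea0.
have ma : Num.min ea eb <= ea by rewrite ge_min lexx.
have mb : Num.min ea eb <= eb by rewrite ge_min lexx orbT.
have c1 : 1 < c by rewrite /c; lra.
have cm : normc (c%:C - 1) = Num.min ea eb / 2.
  by rewrite /c rmorphD /= addrC addKr normc_real gtr0_norm // divr_gt0.
have Dca : D (wscale k c%:C a) by apply: hea; rewrite cm; lra.
have Dcb : D (wscale k c%:C b) by apply: heb; rewrite cm; lra.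
pose orb v := (fun s : C => wscale k s (wscale k c%:C v)) @` [set s | normc s <= 1].
have corb v : compact (orb v).
  apply: continuous_compact; last exact: compact_disc.
  apply: continuous_in_subspaceT => s _.
  apply: (@continuous_wscale _ _ k C id (fun=> wscale k c%:C v)); first exact: cvg_id.
  exact: cst_continuous.
have orbD v : D (wscale k c%:C v) -> orb v `<=` D.
  by move=> Dv _ [s s1 <-]; apply: balD; rewrite ?norm_normc ?lecR.
have [||D' [[_ oD' _] KD' D'D [G [[_ oG _] vG] [f [g [hf hg [fD gG] fgK _]]]]]] :=
    exD (orb a `|` orb b).
- exact: compactU.
- by move=> v [/(orbD a Dca)|/(orbD b Dcb)].
have cC : c%:C != 0 :> C by rewrite -normc_gt0 normc_real gtr0_norm; lra.
have inorb v (lam : C) : normc lam <= c -> orb v (wscale k lam v).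
  move=> lc; exists (lam / c%:C) => /=; last by rewrite wscaleM divfK.
  by rewrite normcM normcV normc_real gtr0_norm ?ler_pdivrMr ?mul1r //; lra.
have D'a (lam : C) : normc lam <= c -> D' (wscale k lam a).
  by move=> lc; apply: KD'; left; exact: inorb.
have D'b (lam : C) : normc lam <= c -> D' (wscale k lam b).
  by move=> lc; apply: KD'; right; exact: inorb.
have D'0 : D' 0.
  by rewrite -(@wscale0 _ _ k a k0); apply: D'a; rewrite normc0; lra.
have Gf v : D' v -> G (f v) by move=> Dv; apply: fD; exists v.
pose q (lam : C) := r%:C *: f (wscale k lam a) + (1 - r)%:C *: f (wscale k lam b).
have Gq lam : normc lam <= c -> G (q lam).
  move=> lc; apply: ((convex_setP G).1 vG); first by rewrite r0.
    by apply: Gf; exact: D'a.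
  by apply: Gf; exact: D'b.
pose phi lam := g (q lam).
have D'phi lam : normc lam <= c -> D' (phi lam).
  by move=> lc; apply: gG; exists (q lam) => //; exact: Gq.
have dws v lam : differentiable (fun s : C => wscale k s v) lam.
  apply: (@differentiable_wscale _ _ k id (fun=> v)).
    by apply/derivable1_diffP; exact: derivable_id.
  exact: differentiable_cst.
have dphi lam : normc lam <= c -> differentiable phi lam.
  move=> lc; apply: (@differentiable_comp _ _ _ _ q g); last by apply: hg; exact: Gq.
  apply: (@differentiableD _ _ _ (fun s => r%:C *: f (wscale k s a))
                                (fun s => (1 - r)%:C *: f (wscale k s b))).
    apply: (@differentiableZ _ _ _ (fun s => f (wscale k s a))).
    apply: (@differentiable_comp _ _ _ _ (fun s => wscale k s a) f); first exact: dws.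
    by apply: hf; exact: D'a.
  apply: (@differentiableZ _ _ _ (fun s => f (wscale k s b))).
  apply: (@differentiable_comp _ _ _ _ (fun s => wscale k s b) f); first exact: dws.
  by apply: hf; exact: D'b.
pose x := r%:C *: a + (1 - r)%:C *: b.
pose h (lam : C) : V :=
  \row_i (if lam == 0 then x ord0 i else phi lam ord0 i / lam ^+ k i).
have h0 : h 0 = x by apply/rowP => i; rewrite mxE eqxx.
rewrite -/x -h0; apply: (@balanced_disc _ _ k D h k0 balD clD); last first.
  move=> lam l1.
  have l0 : lam != 0 by rewrite -normc_gt0 l1.
  have -> : h lam = wscale k lam^-1 (phi lam).
    by apply/rowP => i; rewrite !mxE (negbTE l0) exprVn mulrC.
  apply: balD; first by rewrite norm_normc lecR normcV l1 invr1.
  by apply: D'D; apply: D'phi; lra.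
have dh i lam : lam != 0 -> normc lam < c -> differentiable (fun s => h s ord0 i : C) lam.
  move=> l0 lc; apply: (@near_eq_differentiable _ (fun s => phi s ord0 i / s ^+ k i)).
    have : nbhs lam [set s : C | s != 0].
      apply/nbhsC; exists (normc lam); first by rewrite normc_gt0.
      move=> s sl; apply/eqP => s0; move: sl; rewrite s0 sub0r normcN; lra.
    by apply: filterS => s s0; rewrite mxE (negbTE s0).
  apply: differentiable_mul; first by apply: differentiable_coordV; apply: dphi; lra.
  apply: (@differentiableV C C (fun s => s ^+ k i)); first exact: differentiable_exp.
  exact: expf_neq0.
move=> lam l1; apply: differentiable_rV => i.
have [->|l0] := eqVneq lam 0; last by apply: dh => //; lra.
apply: (@removable_singularity R _ c); [lra| |by move=> t t0 tc; exact: dh].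
have nD'0 : nbhs (0 : V) D' by apply: open_nbhs_nbhs; split.
have nGf0 : nbhs (f 0) G by apply: open_nbhs_nbhs; split=> //; exact: Gf.
have df0 : \forall v \near (0 : V), differentiable f v by apply: filterS nD'0 => v /hf.
have dg0 : \forall v \near f 0, differentiable g v by apply: filterS nGf0 => v /hg.
have gf0 : \forall v \near (0 : V), g (f v) = v.
  by apply: filterS nD'0 => v Dv; apply: fgK; rewrite inE.
have nr : normc r%:C <= 1 by rewrite normc_real ger0_norm.
have nr' : normc (1 - r)%:C <= 1 by rewrite normc_real ger0_norm; lra.
have rr : r%:C + (1 - r)%:C = 1 :> C by rewrite complex_onem addrC subrK.
have [K1 [e [K10 e0 hK]]] := convex_comb_expansion nr nr' rr df0 dg0 gf0.
pose M := \sum_i normc (a ord0 i) + \sum_i normc (b ord0 i).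
have sa0 : 0 <= \sum_i normc (a ord0 i) by apply: sumr_ge0 => l _; exact: normc_ge0.
have sb0 : 0 <= \sum_i normc (b ord0 i) by apply: sumr_ge0 => l _; exact: normc_ge0.
have M0 : 0 <= M by rewrite /M; lra.
have aM l : normc (a ord0 l) <= M.
  have := @term_le_sum R _ (fun l => normc (a ord0 l)) l (fun l => normc_ge0 _).
  rewrite /M; lra.
have bM l : normc (b ord0 l) <= M.
  have := @term_le_sum R _ (fun l => normc (b ord0 l)) l (fun l => normc_ge0 _).
  rewrite /M; lra.
have kap0 : (0 < kap)%N by have := kkap i; case: (kap).
have M1 : 0 < M + 1 by lra.
(* The exponent 2 kap - k i is at least 1. *)
have lip t : normc t <= 1 -> normc t <= e / (M + 1) ->
    normc (h t ord0 i - h 0 ord0 i) <= K1 * M ^+ 2 * normc t.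
  move=> t1 te; have [->|t0] := eqVneq t 0.
    by rewrite subrr normc0 mulr0.
  have t00 : 0 < normc t by rewrite normc_gt0.
  have te' : 0 <= M * normc t ^+ kap <= e.
    rewrite mulr_ge0 ?exprn_ge0 ?normc_ge0 //=.
    have : normc t ^+ kap <= normc t by rewrite -[leRHS]expr1 ler_wiXn2l // normc_ge0.
    move: te; rewrite ler_pdivlMr // => te; nra.
  have := hK _ _ _ te' (normc_wscale_le t1 aM ha) (normc_wscale_le t1 bM hb) i.
  rewrite !add0r -/(q t) -/(phi t).
  have -> : (r%:C *: wscale k t a + (1 - r)%:C *: wscale k t b) ord0 i =
      t ^+ k i * x ord0 i by rewrite /x !mxE; ring.
  move=> hphi; rewrite h0 mxE (negbTE t0).
  have tk : 0 < normc t ^+ k i by rewrite exprn_gt0.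
  have := normc_quot (phi t ord0 i) (x ord0 i) (expf_neq0 (k i) t0).
  rewrite normcX [_ * phi t _ _]mulrC [x _ _ * _]mulrC => E.
  rewrite -(ler_pM2r tk) E; apply: (le_trans hphi).
  have -> : K1 * (M * normc t ^+ kap) ^+ 2 = K1 * M ^+ 2 * normc t ^+ (kap * 2).
    by rewrite exprMn -exprM mulrA.
  have -> : K1 * M ^+ 2 * normc t * normc t ^+ k i = K1 * M ^+ 2 * normc t ^+ (k i).+1.
    by rewrite (exprS (normc t) (k i)) [RHS]mulrA.
  apply: ler_wpM2l; first by rewrite mulr_ge0 ?sqr_ge0.
  by apply: ler_wiXn2l; rewrite ?normc_ge0 // mulnC; exact: kkap.
move=> A /nbhsC[d d0 hA].
have KM0 : 0 <= K1 * M ^+ 2 by rewrite mulr_ge0 ?sqr_ge0.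
have KM1 : 0 < K1 * M ^+ 2 + 1 by lra.
apply: (nbhsC _ _).2; exists (Num.min (Num.min 1 (e / (M + 1))) (d / (K1 * M ^+ 2 + 1))).
  by rewrite !lt_min ltr01 !divr_gt0.
move=> t; rewrite subr0 !lt_min => /andP[/andP[/ltW t1 /ltW t2] t3].
apply: hA; apply: le_lt_trans (lip t t1 t2) _.
move: t3; rewrite ltr_pdivlMr // => t3; have := normc_ge0 t; nra.
Qed.

End Main.

(* The dimension is n.+1, and coordinates and weights are indexed from 0:
   k m is the weight of index m + 1 and k ord_max is the last weight. *)
Theorem theorem4p2 (R : realType) (n : nat) (k : 'I_n.+1 -> nat)
    (k_gt0 : forall i, (0 < k i)%N)
    (k_homo : {homo k : i j / (i <= j)%N})
    (D : set 'rV[R[i]]_n.+1)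
    (D_domain : domain D)
    (D_balanced : weighted_balanced k D)
    (D_classE : classE D)
    (m : 'I_n.+1) (hm : (k ord_max < 2 * k m)%N) :
  convex_set (coord_slice m D).
Proof.
apply/convex_setP => a b r r01 [Da a0] [Db b0]; split; last first.
  by move=> i im; rewrite !mxE a0 // b0 // !mulr0 addr0.
have hi (v : 'rV[R[i]]_n.+1) : (forall i : 'I_n.+1, (i < m)%N -> v ord0 i = 0) ->
    forall i, v ord0 i = 0 \/ (k m <= k i)%N.
  move=> v0 i; have [/v0|mi] := ltnP i m; first by left.
  by right; apply: k_homo.
apply: (weighted_combination k_gt0 _ D_balanced D_classE r01 Da Db (hi a a0) (hi b b0)).
by move=> i; apply: leq_ltn_trans hm; apply: k_homo; exact: leq_ord.
Qed.
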